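(* Consider $N$ agents, the behavior system (leader), and the communication graph described in the context. Suppose that: (A1) the communication graph $\mathcal{G}$ is connected; (A2) $n_i^x\le n_0^w$ for every $i\in\{1,\dots,N\}$; (A3) for every $i\in\{1,\dots,N\}$ there is a constant $M>0$ such that $|g_i(z_i+\Delta,x_i)-g_i(z_i,x_i)|\le M\|\Delta\|$ for all $z_i,\Delta\in\mathbb{R}^{n_i^z}$ and $x_i\in\mathbb{R}^{n_i^x}$. Let $P\in\mathbb{R}^{n_0^w\times n_0^w}$ be a symmetric positive definite matrix satisfying $S^{\top}P+PS<2Pdd^{\top}P$. Then the coordination problem is solved by the following distributed adaptive control law (which does not use $v$, its bound $l$, or any eigenvalue of the graph), for $i=1,\dots,N$: $$ \begin{aligned} u_i&=-g_i(\xi_i,x_i)+x_{i(n_i^x+1)},\\ \dot{x}_{ij}&=x_{i(j+1)},\qquad j=n_i^x+1,\dots,n_0^w-1,\\ \dot{x}_{in_0^w}&=\sum_{j=1}^{n_0^w}s_j^0x_{ij}-d_{n_0^w}\theta_i\,d^{\top}P\hat x_{vi}-d_{n_0^w}\theta_i\,\mathrm{sgn}(d^{\top}P\hat x_{vi}),\\ \dot{\theta}_i&=\|d^{\top}P\hat x_{vi}\|_2^2+\|d^{\top}P\hat x_{vi}\|_1,\\ \dot{\xi}_i&=A_i^0\xi_i+f_i(x_i), \end{aligned} $$ where $\hat x_{vi}=\sum_{j=0}^{N}a_{ij}(\hat x_i-\hat x_j)$, $\hat x_0=w$, $\hat x_i=\mathrm{col}(x_{i1},\dots,x_{in_0^w})$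 for $i\ge1$, and where $\xi_i\in\mathbb{R}^{n_i^z}$, $\theta_i\in\mathbb{R}$ and $x_{i(n_i^x+1)},\dots,x_{in_0^w}\in\mathbb{R}$ are the controller states. If $n_i^x=n_0^w$, there are no additional states $x_{ij}$ with $j>n_i^x$, and $x_{i(n_i^x+1)}$ in the formula for $u_i$ is replaced by the right-hand side of the displayed equation for $\dot x_{in_0^w}$. Solutions of the closed-loop system, whose right-hand side is discontinuous, are understood in the sense of Filippov.
   Context: **Notation.** $\mathrm{col}(a_1,\dots,a_n)=[a_1^{\top},\dots,a_n^{\top}]^{\top}$. For symmetric matrices, $A<B$ means that $B-A$ is positive definite. A matrix is Hurwitz if all its eigenvalues have negative real part. $\mathrm{sgn}$ is the sign function. Since $d^{\top}P\hat x_{vi}$ is a scalar, $\|\cdot\|_2^2$ and $\|\cdot\|_1$ applied to it are its square and its absolute value. **Filippov solutions.** For $\dot x=f(x,t)$ with $f:\mathbb{R}^m\times\mathbb{R}\to\mathbb{R}^m$ measurable and essentially locally bounded, a Filippov solution on $[t_0,t_1]$ is an absolutely continuous $x(\cdot)$ with $\dot x(t)\in\mathcal{F}[f](x(t),t)$ for almost all $t\in[t_0,t_1]$. Here $\mathcal{F}[f](z,t)=\bigcap_{\delta>0}\bigcap_{\mu(\bar N)=0}\overline{\mathrm{co}}\,f(B(z,\delta)\setminus\bar N,t)$, where the inner intersection is over all sets $\bar N$ of Lebesgue measure zero, $\overline{\mathrm{co}}$ is the convex closure, and $B(z,\delta)$ is the open ball of radius $\delta$ centered at $z$. **Agents.**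 For $i=1,\dots,N$, agent $i$ has dynamics $$\dot z_i=A_i^0z_i+f_i(x_i),\quad \dot x_{i1}=x_{i2},\ \dots,\ \dot x_{i(n_i^x-1)}=x_{in_i^x},\quad \dot x_{in_i^x}=u_i+g_i(z_i,x_i),\quad y_i=x_{i1},$$ with $z_i\in\mathbb{R}^{n_i^z}$, $x_i=\mathrm{col}(x_{i1},\dots,x_{in_i^x})\in\mathbb{R}^{n_i^x}$, $n_i^x\ge1$, and input and output $u_i,y_i\in\mathbb{R}$. The matrix $A_i^0$ is Hurwitz, and $f_i,g_i$ are infinitely differentiable. (The high-frequency gain, a positive constant multiplying $u_i$, is normalized to $1$ throughout.) **Behavior system (leader, agent 0).** $\dot w=Sw+dv(t)$, $y_r=c^{\top}w$, with $w\in\mathbb{R}^{n_0^w}$ and $y_r,v(t)\in\mathbb{R}$, where $v$ is continuous in $t$ and $|v(t)|\le l$ for some positive constant $l$. The system is minimal with no zero dynamics and is written in the coordinates where $S$ is the companion matrix with ones on the superdiagonal, last row $(s_1^0,s_2^0,\dots,s_{n_0^w}^0)$, and all other entries zero; $d=\mathrm{col}(0,\dots,0,d_{n_0^w})$ with $d_{n_0^w}\neq0$; and $c=\mathrm{col}(1,0,\dots,0)$. **Communication graph.** $\mathcal{G}$ is a weighted digraph on nodes $\{0,1,\dots,N\}$ (node $0$ is the leader) with weights $a_{ij}\ge0$ and $a_{ii}=0$; $a_{ij}>0$ if and only if there is an edge from $j$ to $i$, i.e. agent $i$ can use information of agent $j$. Also $a_{0i}=0$ for $i=1,\dots,N$.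 $\mathcal{G}$ is called connected if there is a directed path from node $0$ to every other node and the subgraph induced on $\{1,\dots,N\}$ is undirected ($a_{ij}=a_{ji}$ for $i,j\ge1$). **Coordination problem.** A control law, with controller states collected in a vector $x_i^c$ for each agent $i$, solves the coordination problem if, for every real-valued input $v$ of the behavior system that is continuous in $t$ and satisfies $|v(t)|\le l$ for all $t$ for some positive constant $l$, and every initial condition of $z_i,x_i,x_i^c$ ($i=1,\dots,N$) and $w$, the tracking errors $e_i=y_i-y_r$ of the resulting composite system satisfy $\lim_{t\to+\infty}e_i(t)=0$ for all $i\in\{1,\dots,N\}$. *)

(* Defs.v *)
From HB Require Import structures.
From mathcomp Require Import all_boot all_order all_algebra complex.
From mathcomp Require Import all_classical all_reals all_analysis.

Set Implicit Arguments.
Unset Strict Implicit.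
Unset Printing Implicit Defensive.

Import Order.TTheory GRing.Theory Num.Theory.
Import numFieldNormedType.Exports.

Local Open Scope classical_set_scope.
Local Open Scope ring_scope.

Definition posdef (R : realType) (n : nat) (M : 'M[R]_n) : Prop :=
  M^T = M /\ forall x : 'cV[R]_n, x != 0 -> 0 < (x^T *m M *m x) 0 0.

Definition hurwitz (R : realType) (n : nat) (A : 'M[R]_n) : Prop :=
  forall lambda : R[i],
    eigenvalue (map_mx (real_complex R) A) lambda -> complex.Re lambda < 0.

(* The library norm on matrices is the max norm; this is the Euclidean one. *)
Definition enorm (R : realType) (n : nat) (x : 'cV[R]_n) : R :=
  Num.sqrt (\sum_(i < n) x i 0 ^+ 2).

Fixpoint Ck (R : realType) (U V : normedModType R) (k : nat) (f : U -> V) :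
    Prop :=
  match k with
  | 0 => continuous f
  | k'.+1 => (forall x : U, differentiable f x) /\
             (forall v : U, Ck k' (fun x => 'D_v f x))
  end.

Definition smooth (R : realType) (U V : normedModType R) (f : U -> V) : Prop :=
  forall k, Ck k f.

(* Zero-based access by a natural number: entry x k is x_(k+1), and 0 out of
   range. *)
Definition entry (R : realType) (n : nat) (x : 'cV[R]_n) (k : nat) : R :=
  if insub k is Some i then x (i : 'I_n) 0 else 0.

(* Lebesgue measure zero in R^m: for every e > 0, a countable cover by closed
   boxes of total volume at most e. *)
Definition null_set (R : realType) (m : nat) (A : set 'cV[R]_m) : Prop :=
  forall e : R, 0 < e ->
    exists a b : nat -> 'cV[R]_m,
      [/\ forall k i, a k i 0 <= b k i 0,
          A `<=` \bigcup_k [set x | forall i, a k i 0 <= x i 0 <= b k i 0] &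
          (\sum_(0 <= k <oo) (\prod_(i < m) (b k i 0 - a k i 0))%:E <= e%:E)%E].

Definition eball (R : realType) (m : nat) (z : 'cV[R]_m) (delta : R) :
    set 'cV[R]_m :=
  [set x | enorm (x - z) < delta].

Definition closed_convex_hull (R : realType) (m : nat) (A : set 'cV[R]_m) :
    set 'cV[R]_m :=
  smallest [set C : set 'cV[R]_m | closed C /\ convex_set C] A.

Definition filippov (R : realType) (m : nat) (F : 'cV[R]_m -> R -> 'cV[R]_m)
    (z : 'cV[R]_m) (t : R) : set 'cV[R]_m :=
  \bigcap_(delta in [set delta : R | 0 < delta])
    \bigcap_(A in [set A : set 'cV[R]_m | null_set A])
      closed_convex_hull ((fun x => F x t) @` (eball z delta `\` A)).

Definition abs_continuous (R : realType) (m : nat) (t0 t1 : R)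
    (X : R -> 'cV[R]_m) : Prop :=
  forall e : R, 0 < e -> exists2 delta : R, 0 < delta &
    forall (k : nat) (a b : 'I_k -> R),
      (forall i, [/\ t0 <= a i, a i <= b i & b i <= t1]) ->
      (forall i j, i != j -> b i <= a j \/ b j <= a i) ->
      \sum_(i < k) (b i - a i) < delta ->
      \sum_(i < k) enorm (X (b i) - X (a i)) < e.

Definition filippov_solution (R : realType) (m : nat)
    (F : 'cV[R]_m -> R -> 'cV[R]_m) (t0 t1 : R) (X : R -> 'cV[R]_m) : Prop :=
  abs_continuous t0 t1 X /\
  {ae @lebesgue_measure R, forall t, t0 <= t <= t1 ->
     derivable X t 1 /\ filippov F (X t) t ('D_1 X t)}.

(* Plant  z' = agent_A z + agent_f x,  x_j' = x_(j+1) for j < xdim,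
   x_xdim' = u + agent_g z x,  with output y = x_1. *)
Record agent (R : realType) := Agent {
  zdim : nat;
  xdim : nat;
  agent_A : 'M[R]_zdim;
  agent_f : 'cV[R]_xdim -> 'cV[R]_zdim;
  agent_g : 'cV[R]_zdim -> 'cV[R]_xdim -> R }.

Definition agent_wf (R : realType) (ag : agent R) : Prop :=
  [/\ (1 <= xdim ag)%N, hurwitz (agent_A ag), smooth (agent_f (a := ag)) &
      smooth (fun p : 'cV[R]_(zdim ag) * 'cV[R]_(xdim ag) => agent_g p.1 p.2)].

Definition zdyn (R : realType) (ag : agent R)
    (z : 'cV[R]_(zdim ag)) (x : 'cV[R]_(xdim ag)) : 'cV[R]_(zdim ag) :=
  agent_A ag *m z + agent_f x.

Definition xdyn (R : realType) (ag : agent R)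
    (z : 'cV[R]_(zdim ag)) (x : 'cV[R]_(xdim ag)) (u : R) :
    'cV[R]_(xdim ag) :=
  \col_(j < xdim ag) if (j.+1 < xdim ag)%N then entry x j.+1 else u + agent_g z x.

(* The leader w' = S w + d v, y_r = c^T w is given directly in its controllable
   companion form; with dn != 0 minimality (controllable, observable) and the
   absence of zero dynamics (relative degree n0) follow from this form. *)
Definition Smx (R : realType) (n0 : nat) (s0 : 'I_n0 -> R) : 'M[R]_n0 :=
  \matrix_(i, j) if (i.+1 < n0)%N then (j == i.+1 :> nat)%:R else s0 j.

Definition dvec (R : realType) (n0 : nat) (dn : R) : 'cV[R]_n0 :=
  \col_(i < n0) if (i.+1 < n0)%N then 0 else dn.

Definition cvec (R : realType) (n0 : nat) : 'cV[R]_n0 :=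
  \col_(i < n0) (i == 0 :> nat)%:R.

(* Node 0 is the leader and agent i : 'I_N is node lift ord0 i. *)
Definition digraph_weights (R : realType) (N : nat) (a : 'M[R]_N.+1) : Prop :=
  [/\ forall i j, 0 <= a i j, forall i, a i i = 0 &
      forall i : 'I_N, a ord0 (lift ord0 i) = 0].

Definition graph_connected (R : realType) (N : nat) (a : 'M[R]_N.+1) : Prop :=
  (forall i : 'I_N.+1, connect [rel j k : 'I_N.+1 | 0 < a k j] ord0 i) /\
  (forall i j : 'I_N, a (lift ord0 i) (lift ord0 j) =
                      a (lift ord0 j) (lift ord0 i)).

Record cstate (R : realType) (N n0 : nat) (ag : 'I_N -> agent R)
    (nc : 'I_N -> nat) := CState {
  st_w : 'cV[R]_n0;
  st_z : forall i, 'cV[R]_(zdim (ag i));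
  st_x : forall i, 'cV[R]_(xdim (ag i));
  st_c : forall i, 'cV[R]_(nc i) }.

(* The laws may read the whole composite state but not t (hence not v). *)
Record controller (R : realType) (N n0 : nat) (ag : 'I_N -> agent R) :=
  Controller {
    cdim : 'I_N -> nat;
    cinput : cstate n0 ag cdim -> 'I_N -> R;
    cdyn : cstate n0 ag cdim -> forall i, 'cV[R]_(cdim i) }.

Definition agent_dim (R : realType) (N : nat) (ag : 'I_N -> agent R)
    (nc : 'I_N -> nat) (i : 'I_N) : nat :=
  (zdim (ag i) + (xdim (ag i) + nc i))%N.

Definition total_dim (R : realType) (N n0 : nat) (ag : 'I_N -> agent R)
    (nc : 'I_N -> nat) : nat :=
  (n0 + \sum_(i < N) agent_dim ag nc i)%N.

Definition pack (R : realType) (N n0 : nat) (ag : 'I_N -> agent R)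
    (nc : 'I_N -> nat) (s : cstate n0 ag nc) :
    'cV[R]_(total_dim n0 ag nc) :=
  col_mx (st_w s)
    (\mxcol_(i < N)
       (col_mx (st_z s i) (col_mx (st_x s i) (st_c s i))
         : 'cV[R]_(agent_dim ag nc i))).

Definition unpack (R : realType) (N n0 : nat) (ag : 'I_N -> agent R)
    (nc : 'I_N -> nat) (X : 'cV[R]_(total_dim n0 ag nc)) : cstate n0 ag nc :=
  let B i : 'cV[R]_(zdim (ag i) + (xdim (ag i) + nc i)) :=
    submxcol (dsubmx X) i in
  CState (usubmx X) (fun i => usubmx (B i))
    (fun i => usubmx (dsubmx (B i))) (fun i => dsubmx (dsubmx (B i))).

Definition closed_loop (R : realType) (N n0 : nat) (ag : 'I_N -> agent R)
    (s0 : 'I_n0 -> R) (dn : R) (K : controller n0 ag) (v : R -> R)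
    (X : 'cV[R]_(total_dim n0 ag (cdim K))) (t : R) :
    'cV[R]_(total_dim n0 ag (cdim K)) :=
  let s := unpack X in
  pack (CState (Smx s0 *m st_w s + v t *: dvec n0 dn)
    (fun i => zdyn (st_z s i) (st_x s i))
    (fun i => xdyn (st_z s i) (st_x s i) (cinput s i))
    (cdyn s)).

Definition tracking_error (R : realType) (N n0 : nat) (ag : 'I_N -> agent R)
    (nc : 'I_N -> nat) (X : 'cV[R]_(total_dim n0 ag nc)) (i : 'I_N) : R :=
  let s := unpack X in
  entry (st_x s i) 0 - ((cvec R n0)^T *m st_w s) 0 0.

(* The first conjunct rules out finite escape, without which the limit at
   +oo would not constrain the solutions blowing up at some T < +oo. *)
Definition solves_coordination (R : realType) (N n0 : nat)
    (ag : 'I_N -> agent R) (s0 : 'I_n0 -> R) (dn : R) (K : controller n0 ag) :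
    Prop :=
  forall v : R -> R, continuous v ->
  (exists2 l : R, 0 < l & forall t, `|v t| <= l) ->
  forall (t0 : R) (X0 : 'cV[R]_(total_dim n0 ag (cdim K)))
         (X : R -> 'cV[R]_(total_dim n0 ag (cdim K))),
  X t0 = X0 ->
  (forall T : R, t0 < T ->
     (forall t1, t0 < t1 < T ->
        filippov_solution (closed_loop s0 dn v) t0 t1 X) ->
     exists C : R, forall t, t0 <= t < T -> enorm (X t) <= C) /\
  ((forall t1, t0 < t1 -> filippov_solution (closed_loop s0 dn v) t0 t1 X) ->
   forall i : 'I_N, tracking_error (X t) i @[t --> +oo] --> (0 : R)).

Section AdaptiveLaw.
Context (R : realType) (N n0 : nat) (ag : 'I_N -> agent R) (s0 : 'I_n0 -> R)
  (dn : R) (a : 'M[R]_N.+1) (P : 'M[R]_n0).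

(* Controller state of agent i: (x_(i,xdim+1), ..., x_(i,n0)), theta_i, xi_i. *)
Definition law_dim (i : 'I_N) : nat :=
  ((n0 - xdim (ag i)) + (1 + zdim (ag i)))%N.

Implicit Type s : cstate n0 ag law_dim.

Definition st_chi s (i : 'I_N) : 'cV[R]_(n0 - xdim (ag i)) :=
  usubmx (st_c s i).
Definition st_theta s (i : 'I_N) : R := (usubmx (dsubmx (st_c s i))) 0 0.
Definition st_xi s (i : 'I_N) : 'cV[R]_(zdim (ag i)) :=
  dsubmx (dsubmx (st_c s i)).

Definition xhat s (i : 'I_N) : 'cV[R]_n0 :=
  \col_(k < n0) if (k < xdim (ag i))%N then entry (st_x s i) k
                else entry (st_chi s i) (k - xdim (ag i)).

Definition xhat_node s (j : 'I_N.+1) : 'cV[R]_n0 :=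
  if unlift ord0 j is Some i then xhat s i else st_w s.

Definition xhat_v s (i : 'I_N) : 'cV[R]_n0 :=
  \sum_(j < N.+1) a (lift ord0 i) j *: (xhat s i - xhat_node s j).

Definition sigma s (i : 'I_N) : R :=
  ((dvec n0 dn)^T *m P *m xhat_v s i) 0 0.

(* Right-hand side of the equation of x_(i,n0); it is fed to the plant through
   u_i when xdim = n0 and drives the last controller state otherwise. *)
Definition last_rhs s (i : 'I_N) : R :=
  \sum_(j < n0) s0 j * xhat s i j 0 - dn * st_theta s i * sigma s i
  - dn * st_theta s i * Num.sg (sigma s i).

Definition law_input s (i : 'I_N) : R :=
  - agent_g (st_xi s i) (st_x s i) +
  (if (xdim (ag i) < n0)%N then entry (st_chi s i) 0 else last_rhs s i).

Definition law_dyn s (i : 'I_N) : 'cV[R]_(law_dim i) :=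
  col_mx
    (\col_(k < n0 - xdim (ag i))
       if (k.+1 < n0 - xdim (ag i))%N then entry (st_chi s i) k.+1
       else last_rhs s i)
    (col_mx (const_mx (sigma s i ^+ 2 + `|sigma s i|))
       (agent_A (ag i) *m st_xi s i + agent_f (st_x s i))).

Definition adaptive_law : controller n0 ag := Controller law_input law_dyn.

End AdaptiveLaw.

(* Main.v *)
(* Write e_i for the synchronization errors (xhat_i - w), H for the Laplacian of
   the followers augmented by the links to the leader, and s_i = d^T P (H e)_i
   for the feedback signals.  The Lyapunov function is
     V = sum_ij H_ij e_i^T P e_j + sum_i (theta_i - G)^2 + kap sum_i Q_i(z_i - xi_i)
   with Q_i a quadratic Lyapunov function of A_i^0.  The constant G exceeds both
   the bound of v and a constant C with e^T H e <= C |H e|^2; then the adaptive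
   terms cancel the unknown gains, the matrix inequality gives decay in e, and
   kap absorbs the mismatch g_i(z_i, x_i) - g_i(xi_i, x_i).

   The signum terms enter the derivative of V only through s_i sgn(s_i), so for
   fixed z the map x |-> dV(z)(F x) is continuous at x = z, and every element of
   the Filippov set at z gives dV the value dV(z)(F z).  Hence V is nonincreasing
   along solutions, which bounds e, theta and z - xi; w and xi then grow at most
   exponentially, which excludes finite escape.  Finally V' <= -c W for
   W = sum_ij H_ij e_i^T P e_j, and W has bounded derivative, so W -> 0. *)

Require Import Defs.
From mathcomp Require Import all_boot all_order all_algebra complex.
From mathcomp Require Import all_classical all_reals all_analysis.
From mathcomp Require Import measurable_realfun ring lra.

Import Order.TTheory GRing.Theory Num.Theory.
Import numFieldNormedType.Exports.

Local Open Scope classical_set_scope.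
Local Open Scope ring_scope.

Set Implicit Arguments.
Unset Strict Implicit.

(** * Absolutely continuous functions with nonpositive derivative *)

(** The estimates behind the convergence are therefore made in quantities from which [w] has
    disappeared. Two facts allow this: the controller states prolong each plant to a chain of length
    [n0] with the leader's companion matrix, so that [e_i] obeys an equation with matrix [S] up to
    inputs; and the nonlinearity survives only in the mismatch of [g_i], which (A3) bounds by
    [z_i - xi_i] uniformly in [x_i]. The gains may start negative; since [s sgn(s) = |s|], the terms
    in [theta_i] cancel identically, whatever their sign. V is a quadratic form evaluated at the
    state minus a fixed center, so its derivative is a linear functional of the velocity: just what
    a closed convex hull controls. Solutions are differentiable only almost everywhere, so each
    bound on a derivative is turned into a bound on increments, and the asymptotic argument uses
    increments alone. *)

Definition ac_on (R : realType) (a b : R) (f : R -> R) : Prop :=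
  forall e : R, 0 < e -> exists2 d : R, 0 < d &
    forall (k : nat) (u v : 'I_k -> R),
      (forall i, [/\ a <= u i, u i <= v i & v i <= b]) ->
      (forall i j, i != j -> v i <= u j \/ v j <= u i) ->
      \sum_(i < k) (v i - u i) < d ->
      \sum_(i < k) `|f (v i) - f (u i)| < e.

Section monotone.
Context (R : realType).
Local Notation mu := (@lebesgue_measure R).

Lemma straddle (f : R -> R) (t D e : R) : is_derive t 1 f D -> D <= 0 -> 0 < e ->
  exists2 r, 0 < r & forall u v, u <= t <= v -> t - r < u -> v < t + r ->
    f v - f u <= e * (v - u).
Proof.
move=> fD D0 e0.
have fd : h^-1 *: (f (h *: 1 + t) - f t) @[h --> 0^'] --> D.
  by case: fD => df <-; exact: df.
move/cvgrPdist_le : fd => /(_ e e0) [r /= r0 H].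
(* Multiplying the difference quotient by [h ^+ 2] covers both signs of [h] at once. *)
have one h : `|h| < r -> h * (f (t + h) - f t) <= h ^+ 2 * e.
  have [->|h0] := eqVneq h 0; first by rewrite !mul0r expr2 !mul0r.
  move=> hr; have := H h; rewrite /= sub0r normrN => /(_ hr h0).
  rewrite ler_norml scaler1 => /andP[+ _].
  rewrite [h + t]addrC => K.
  have : h^-1 * (f (t + h) - f t) <= e.
    by move: K; rewrite /GRing.scale /=; lra.
  move=> /(ler_wpM2l (sqr_ge0 h)); apply: le_trans.
  by rewrite mulrA expr2 mulfK.
exists r => // u v /andP[ut tv] ru vr.
have A : f v - f t <= e * (v - t).
  have [->|vt] := eqVneq v t; first by rewrite !subrr mulr0.
  have vt0 : 0 < v - t by rewrite subr_gt0 lt_neqAle eq_sym vt.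
  have := one (v - t); rewrite gtr0_norm // => /(_ ltac:(lra)).
  rewrite (_ : t + (v - t) = v) ?expr2 -?mulrA ?ler_pM2l // 1?mulrC //; ring.
have B : f t - f u <= e * (t - u).
  have [->|vt] := eqVneq u t; first by rewrite !subrr mulr0.
  have vt0 : 0 < t - u by rewrite subr_gt0 lt_neqAle vt.
  have := one (u - t); rewrite ltr0_norm; last lra.
  move=> /(_ ltac:(lra)).
  rewrite (_ : t + (u - t) = u); last ring.
  rewrite (_ : (u - t) * (f u - f t) = (t - u) * (f t - f u)); last ring.
  by rewrite (_ : (u - t) ^+ 2 * e = (t - u) * (e * (t - u))) ?ler_pM2l //; ring.
lra.
Qed.

(** The intervals are stored from right to left, so a new one goes in front. Their position inside
    [U] is recorded only through the total length, which is what absolute continuity asks for;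
    cutting [U] at [t] keeps the rest of it available for later intervals. *)
Let chain (U : set R) (a t : R) (s : seq (R * R)) :=
  [/\ pairwise (fun p q : R * R => q.2 <= p.1) s,
      (forall p, p \in s -> [/\ a <= p.1, p.1 <= p.2 & p.2 <= t]) &
      ((\sum_(p <- s) (p.2 - p.1))%:E <= mu (U `&` `]-oo, t]))%E].

Lemma ac_sum_chain (a b : R) (f : R -> R) (e d : R) (U : set R) s :
  (forall (k : nat) (u v : 'I_k -> R),
      (forall i, [/\ a <= u i, u i <= v i & v i <= b]) ->
      (forall i j, i != j -> v i <= u j \/ v j <= u i) ->
      \sum_(i < k) (v i - u i) < d ->
      \sum_(i < k) `|f (v i) - f (u i)| < e) ->
  measurable U -> (mu U < d%:E)%E ->
  chain U a b s -> \sum_(p <- s) `|f p.2 - f p.1| < e.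
Proof.
move=> acf mU Ud [ps ins ms].
rewrite (big_nth (0, 0)) big_mkord.
apply: (acf _ (fun i => (nth (0, 0) s i).1) (fun i => (nth (0, 0) s i).2)).
- by move=> i; apply: ins; rewrite mem_nth.
- have H (i j : 'I_(size s)) : (i < j)%N ->
      (nth (0, 0) s j).2 <= (nth (0, 0) s i).1.
    by move=> ij; move/(pairwiseP (0, 0)): ps; apply => //; rewrite inE.
  move=> i j; rewrite -val_eqE neq_ltn => /orP[ij|ij]; [right|left]; exact: H.
- rewrite -lte_fin; apply: le_lt_trans Ud.
  have -> : \sum_(i < size s) ((nth (0, 0) s i).2 - (nth (0, 0) s i).1) =
    \sum_(p <- s) (p.2 - p.1) by rewrite [RHS](big_nth (0,0)) big_mkord.
  apply: le_trans ms _; apply: le_measure; rewrite ?inE //.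
  exact: measurableI.
Qed.

(* Cousin-style supremum argument: the exceptional null set is covered by an open
   set U of small measure; off U increments are controlled by the derivative,
   and those over the intervals of the chain, which lie in U, by absolute
   continuity. *)
Lemma ac_nonincreasing0 (a b : R) (f : R -> R) : a <= b -> ac_on a b f ->
  {ae mu, forall t, a <= t <= b -> exists2 D, D <= 0 & is_derive t 1 f D} ->
  f b <= f a.
Proof.
move=> ab acf [M [mM M0' EM]].
have M0 : mu M = 0%E := M0'.
have Moo : (mu M < +oo)%E by rewrite M0 ltry.
apply/ler_addgt0Pl => e e0.
(* Chosen so that [e1 * (b - a) + e1 = e]: a rate [e1] off [U], and [e1] for the whole chain. *)
pose e1 := e / (b - a + 1).
have e10 : 0 < e1 by rewrite /e1 divr_gt0 //; lra.
have [d d0 acd] := acf e1 e10.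
have [U [oU MU Ud]] := @lebesgue_regularity_outer R M d mM Moo d0.
have mU : measurable U by exact: open_measurable.
have {}Ud : (mu U < d%:E)%E.
  apply: le_lt_trans Ud; rewrite -[X in (_ <= X)%E]adde0 -[X in (_ + X)%E]M0.
  apply: le_trans (measureU2 _ _ _) => //; last exact: measurableD.
  apply: le_measure; rewrite ?inE //.
    by apply: measurableU => //; exact: measurableD.
  by move=> x Ux; have [|] := pselect (M x); [right|left].
pose Good t := exists2 s, chain U a t s &
  f t - f a <= e1 * (t - a) + \sum_(p <- s) `|f p.2 - f p.1|.
have step t : a <= t <= b -> exists2 r, 0 < r & forall u v, a <= u -> v <= b ->
    u <= t <= v -> t - r < u -> v < t + r -> Good u -> Good v.
  move=> tab; have [Ut|nUt] := pselect (U t).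
    have [r /= r0 rU] : \forall x \near t, U x by exact: open_nbhs_nbhs.
    exists r => // u v au vb /andP[ut tv] ru vr [s [ps ins ms] fs].
    have uv : u <= v by lra.
    exists ((u, v) :: s); last first.
      rewrite big_cons /=.
      have := ler_norm (f v - f u).
      have : e1 * (u - a) <= e1 * (v - a) by rewrite ler_pM2l //; lra.
      lra.
    split => /=.
    - rewrite ps andbT; apply/allP => p ps'; by have [] := ins p ps'.
    - move=> p; rewrite inE => /orP[/eqP->//|/ins[? ? ?]]; split => //; lra.
    - rewrite big_cons /= EFinD.
      have -> : (v - u)%:E = mu `]u, v].
        by rewrite lebesgue_measure_itv /= lte_fin; case: ltgtP uv => // -> _; rewrite subrr.
      rewrite addeC; apply: (@le_trans _ _ (mu (U `&` `]-oo, u]) + mu `]u, v])%E).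
        exact: leeD.
      rewrite -measureU //; last first.
      + apply/seteqP; split => x //= []; rewrite !in_itv /= => -[_ xu].
        by rewrite ltNge xu.
      + exact: measurableI.
      apply: le_measure; rewrite ?inE.
      + by apply: measurableU => //; exact: measurableI.
      + exact: measurableI.
      move=> x /= [[Ux]|]; rewrite !in_itv /=.
        by move=> xu; split => //; exact: le_trans uv.
      move=> /andP[ux xv]; split => //; apply: rU.
      by rewrite /= ltr_norml; lra.
  have [D D0 fD] : exists2 D, D <= 0 & is_derive t 1 f D.
    apply: contrapT => nD; apply: nUt; apply: MU; apply: EM => /= H.
    exact/nD/H.
  have [r r0 Hr] := straddle fD D0 e10.
  exists r => // u v au vb utv ru vr [s [ps ins ms] fs].
  have uv : u <= v by move: utv => /andP[]; exact: le_trans.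
  exists s; last first.
    have := Hr _ _ utv ru vr; lra.
  split => //.
  - move=> p /ins[? ? pu]; split => //; exact: le_trans uv.
  - apply: le_trans ms _; apply: le_measure; rewrite ?inE //; try exact: measurableI.
    move=> x /= [Ux]; rewrite !in_itv /= => xu; split => //; exact: le_trans uv.
pose S := [set t | a <= t <= b /\ Good t].
have Sa : S a.
  split; first by rewrite lexx.
  exists [::]; last by rewrite big_nil !subrr mulr0 addr0.
  by split => //; rewrite big_nil.
have supS : has_sup S.
  by split; [exists a|exists b => x [] /andP[]].
set T := sup S.
have aT : a <= T by apply: ub_le_sup => //; case: supS.
have Tb : T <= b by apply: ge_sup; [exists a|move=> x [] /andP[]].
(* The step at [T] carries [Good] from a point just left of [T] to any point just right of it within
   [[a, b]]; hence [T < b] is impossible, and the same step reaches [b]. *)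
have [r r0 Hr] := step T ltac:(by rewrite aT Tb).
have [u [/andP[au ub] Gu] Tu] := @sup_adherent _ S r r0 supS.
have uT : u <= T by apply: ub_le_sup; [case: supS|split => //; rewrite au ub].
have [s cs fs] : Good b.
  have [bT|Tb'] := leP b T.
    apply: (Hr u b) => //; [by rewrite uT|].
    by apply: le_lt_trans bT _; rewrite ltrDl.
  pose v := Num.min b (T + r / 2).
  have vS : S v.
    have vb : v <= b by rewrite /v ge_min lexx.
    have Tv : T <= v by rewrite /v le_min Tb /= lerDl; lra.
    split; first by rewrite vb andbT; lra.
    apply: (Hr u v) => //; [by rewrite uT|].
    by rewrite /v gt_min ltrD2l; apply/orP; right; lra.
  have : v <= T by apply: ub_le_sup => //; case: supS.
  rewrite /v ge_min => /orP[|]; lra.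
have := ac_sum_chain acd mU Ud cs.
have ee : e = e1 * (b - a) + e1 by rewrite /e1; field; lra.
lra.
Qed.

Lemma ac_derive_le (a b c : R) (f : R -> R) : a <= b -> ac_on a b f ->
  {ae mu, forall t, a <= t <= b -> exists2 D, D <= c & is_derive t 1 f D} ->
  f b - f a <= c * (b - a).
Proof.
move=> ab acf aef.
suff : f b - c * b <= f a - c * a by lra.
apply: (@ac_nonincreasing0 a b (fun t => f t - c * t)) => //.
  move=> e e0; have [d d0 H] := acf (e / 2) ltac:(lra).
  have c0 : 0 < 2 * (`|c| + 1) by rewrite mulr_gt0 // ltr_wpDl.
  exists (Num.min d (e / (2 * (`|c| + 1)))).
    by rewrite lt_min d0 divr_gt0.
  move=> k u v uv dis; rewrite lt_min => /andP[sd].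
  rewrite ltr_pdivlMr // => se.
  have {H} He := H k u v uv dis sd.
  have B : \sum_(i < k) `|f (v i) - c * v i - (f (u i) - c * u i)| <=
      \sum_(i < k) `|f (v i) - f (u i)| + `|c| * \sum_(i < k) (v i - u i).
    rewrite mulr_sumr -big_split /=; apply: ler_sum => i _.
    have -> : f (v i) - c * v i - (f (u i) - c * u i) =
      f (v i) - f (u i) - c * (v i - u i) by ring.
    apply: le_trans (ler_normB _ _) _; rewrite normrM lerD2l.
    by have [_ ? _] := uv i; rewrite (@ger0_norm _ (v i - u i)) ?subr_ge0.
  have S0 : 0 <= \sum_(i < k) (v i - u i).
    by apply: sumr_ge0 => i _; have [_ ? _] := uv i; rewrite subr_ge0.
  apply: le_lt_trans B _; nra.
case: aef => M [mM M0 EM]; exists M; split => // t /= nt; apply: EM => /= H.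
apply: nt => /H[D Dc fD].
exists (D - c); first by lra.
apply: is_derive_eq; rewrite /GRing.scale /= mulr1 //.
Qed.

End monotone.

(** * Symmetric bilinear forms and the graph Laplacian *)

(** Stated on an arbitrary module, so that it serves scalars, vectors and the whole state, on which
    the Lyapunov function is itself such a form. *)
Definition symbilin (R : realType) (V : lmodType R) (B : V -> V -> R) : Prop :=
  (forall x y, B x y = B y x) /\
  (forall k x y z, B (k *: x + y) z = k * B x z + B y z).

Section symmetric_bilinear.
Context (R : realType) (V : lmodType R) (B : V -> V -> R) (hB : symbilin B).

Lemma bilC x y : B x y = B y x. Proof. exact: hB.1. Qed.

Lemma bilDl x y z : B (x + y) z = B x z + B y z.
Proof. by have := hB.2 1 x y z; rewrite scale1r mul1r. Qed.

Lemma bil0l z : B 0 z = 0.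
Proof. by apply: (@addrI _ (B 0 z)); rewrite -bilDl !addr0. Qed.

Lemma bilZl k x z : B (k *: x) z = k * B x z.
Proof. by have := hB.2 k x 0 z; rewrite bil0l !addr0. Qed.

Lemma bilBl x y z : B (x - y) z = B x z - B y z.
Proof. by rewrite -scaleN1r addrC hB.2 mulN1r addrC. Qed.

Lemma bilNl x z : B (- x) z = - B x z.
Proof. by rewrite -scaleN1r bilZl mulN1r. Qed.

Lemma bilDr x y z : B x (y + z) = B x y + B x z.
Proof. by rewrite bilC bilDl !(bilC _ x). Qed.

Lemma bilZr k x z : B x (k *: z) = k * B x z.
Proof. by rewrite bilC bilZl (bilC _ x). Qed.

Lemma bilBr x y z : B x (y - z) = B x y - B x z.
Proof. by rewrite bilC bilBl !(bilC _ x). Qed.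

Lemma bilNr x z : B x (- z) = - B x z.
Proof. by rewrite bilC bilNl bilC. Qed.

Lemma bil_suml (I : Type) (r : seq I) (P : pred I) (F : I -> V) z :
  B (\sum_(i <- r | P i) F i) z = \sum_(i <- r | P i) B (F i) z.
Proof. exact: (big_morph (B^~ z) (fun x y => bilDl x y z) (bil0l z)). Qed.

Lemma bil_sumr (I : Type) (r : seq I) (P : pred I) (F : I -> V) z :
  B z (\sum_(i <- r | P i) F i) = \sum_(i <- r | P i) B z (F i).
Proof. by rewrite bilC bil_suml; apply: eq_bigr => i _; rewrite bilC. Qed.

Lemma bil_cauchy_schwarz x y : (forall z, 0 <= B z z) ->
  B x y ^+ 2 <= B x x * B y y.
Proof.
move=> B0.
have H k : 0 <= B x x + 2 * k * B x y + k ^+ 2 * B y y.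
  have := B0 (k *: y + x); rewrite bilDl !bilZl !bilDr !bilZr (bilC y x).
  by congr (_ <= _); ring.
have [y0|y0] := eqVneq (B y y) 0.
  suff -> : B x y = 0 by rewrite expr2 mul0r mulr_ge0.
  apply/eqP; apply: contraT => xy0.
  (* This [k] gives the affine function of [k] the value -1. *)
  have := H (- (B x x + 1) / (2 * B x y)); rewrite y0 mulr0 addr0.
  have -> : 2 * (- (B x x + 1) / (2 * B x y)) * B x y = - (B x x + 1) by field.
  lra.
have y1 : 0 < B y y by rewrite lt_neqAle eq_sym y0 B0.
have := H (- B x y / B y y).
rewrite -(ler_pM2r y1) mul0r.
have -> : (B x x + 2 * (- B x y / B y y) * B x y + (- B x y / B y y) ^+ 2 * B y y) * B y y
  = B x x * B y y - B x y ^+ 2 by field.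
lra.
Qed.

End symmetric_bilinear.

(** * Euclidean inner product and positive definite matrices *)

Section euclidean.
Context (R : realType) (m : nat).
Implicit Types x y : 'cV[R]_m.

Definition dot x y : R := \sum_(i < m) x i 0 * y i 0.

Lemma symbilin_dot : symbilin dot.
Proof.
split=> [x y|k x y z]; first by apply: eq_bigr => i _; rewrite mulrC.
rewrite /dot mulr_sumr -big_split; apply: eq_bigr => i _ /=.
by rewrite !mxE mulrDl mulrA.
Qed.

Lemma dot_ge0 x : 0 <= dot x x.
Proof. by apply: sumr_ge0 => i _; rewrite -expr2 sqr_ge0. Qed.

Lemma dotE x y : dot x y = (x^T *m y) 0 0.
Proof. by rewrite mxE; apply: eq_bigr => i _; rewrite mxE. Qed.

Lemma enorm_sqr x : enorm x ^+ 2 = dot x x.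
Proof.
rewrite sqr_sqrtr; last by apply: sumr_ge0 => i _; exact: sqr_ge0.
by apply: eq_bigr => i _; rewrite expr2.
Qed.

Lemma enorm_ge0 x : 0 <= enorm x. Proof. exact: sqrtr_ge0. Qed.

Lemma coord_le_enorm x i : `|x i 0| <= enorm x.
Proof.
rewrite -sqrtr_sqr ler_wsqrtr // (bigD1 i) //= lerDl.
by apply: sumr_ge0 => j _; exact: sqr_ge0.
Qed.

Lemma col_sum_delta x : x = \sum_i x i 0 *: delta_mx i 0.
Proof.
apply/colP => i; rewrite summxE (bigD1 i) //= big1 => [|j ji].
  by rewrite !mxE !eqxx mulr1 addr0.
by rewrite !mxE eq_sym (negbTE ji) mulr0.
Qed.

Lemma bil_bounded (B : 'cV[R]_m -> 'cV[R]_m -> R) : symbilin B ->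
  exists2 C, 0 <= C & forall x y, `|B x y| <= C * (enorm x * enorm y).
Proof.
move=> hB; exists (\sum_i \sum_j `|B (delta_mx i 0) (delta_mx j 0)|).
  by apply: sumr_ge0 => i _; apply: sumr_ge0.
move=> x y; rewrite {1}[x]col_sum_delta {1}[y]col_sum_delta (bil_suml hB).
rewrite (le_trans (ler_norm_sum _ _ _)) // mulr_suml.
apply: ler_sum => i _; rewrite (bil_sumr hB) (le_trans (ler_norm_sum _ _ _)) //.
rewrite mulr_suml; apply: ler_sum => j _.
rewrite (bilZl hB) (bilZr hB) !normrM mulrA mulrC; apply: ler_wpM2l => //.
by apply: ler_pM => //; exact: coord_le_enorm.
Qed.

Lemma bil_le_dot (B : 'cV[R]_m -> 'cV[R]_m -> R) : symbilin B ->
  exists2 C, 0 < C & forall x, `|B x x| <= C * dot x x.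
Proof.
move=> /bil_bounded[C C0 H]; exists (C + 1); first by rewrite ltr_wpDl.
move=> x; apply: le_trans (H x x) _; rewrite -expr2 enorm_sqr.
by rewrite ler_wpM2r ?dot_ge0 // lerDl.
Qed.

Definition qform (M : 'M[R]_m) x y : R := (x^T *m M *m y) 0 0.

Lemma symbilin_qform M : M^T = M -> symbilin (qform M).
Proof.
move=> hM; split=> [x y|k x y z]; rewrite /qform.
  have -> : y^T *m M *m x = (x^T *m M *m y)^T.
    by rewrite !trmx_mul trmxK hM mulmxA.
  by rewrite [RHS]mxE.
by rewrite linearP !mulmxDl -!scalemxAl !mxE.
Qed.

Lemma dot_mulmx x y (M : 'M[R]_m) : dot x (M *m y) = qform M x y.
Proof. by rewrite dotE mulmxA. Qed.

(* Cauchy-Schwarz for the form M applied to x and M^-1 x. *)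
Lemma posdef_coercive (M : 'M[R]_m) : posdef M ->
  exists2 c, 0 < c & forall x, c * dot x x <= qform M x x.
Proof.
move=> [MT Mpos].
have hM := symbilin_qform MT.
have M0 x : 0 <= qform M x x.
  by have [->|/Mpos/ltW//] := eqVneq x 0; rewrite (bil0l hM).
have uM : M \in unitmx.
  rewrite -unitmx_tr -row_free_unit -kermx_eq0; apply: contraT => K0.
  have [j jK] : exists j, row j (kermx M^T) != 0.
    apply: contrapT => nK; move/negP: K0; apply; apply/eqP/row_matrixP => i.
    by rewrite row0; apply/eqP; apply: contraT => iK; exfalso; apply: nK; exists i.
  have /sub_kermxP := row_sub j (kermx M^T).
  move: jK; set u := row j _ => u0 uMT.
  have := Mpos u^T; rewrite trmxK -mulmxA -[M *m _]trmxK trmx_mul trmxK uMT trmx0.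
  by rewrite mulmx0 mxE ltxx trmx_eq0 => /(_ u0).
have hN : symbilin (qform ((invmx M)^T *m M *m invmx M)).
  by apply: symbilin_qform; rewrite !trmx_mul trmxK MT mulmxA.
have [C C0 HC] := bil_le_dot hN.
exists C^-1; first by rewrite invr_gt0.
move=> x; have := bil_cauchy_schwarz hM x (invmx M *m x) M0.
rewrite -[X in X ^+ 2]dot_mulmx mulKVmx //.
have -> : qform M (invmx M *m x) (invmx M *m x) =
  qform ((invmx M)^T *m M *m invmx M) x x.
  by rewrite /qform trmx_mul !mulmxA.
move=> CS; rewrite ler_pdivrMl //.
have [->|x0] := eqVneq (dot x x) 0; first by rewrite mulr_ge0 // ltW.
have {}x0 : 0 < dot x x by rewrite lt_neqAle eq_sym x0 dot_ge0.
rewrite -(ler_pM2r x0) -expr2; apply: le_trans CS _.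
rewrite [C * _]mulrC -mulrA; apply: ler_wpM2l => //.
by apply: le_trans (HC x); exact: ler_norm.
Qed.

End euclidean.

(** * Laplacian of the followers grounded at the leader *)

Section graph.
Context (R : realType) (N : nat) (a : 'M[R]_N.+1).
Hypotheses (a_weights : digraph_weights a) (a_conn : graph_connected a).
Local Notation L := (lift ord0).

(** The action of [H] tensored with the identity, written on families to avoid Kronecker products;
    the leader's own error is 0, hence the bare [e i] in the first term. *)
Definition laplacian (V : lmodType R) (e : 'I_N -> V) (i : 'I_N) : V :=
  a (L i) ord0 *: e i + \sum_(j < N) a (L i) (L j) *: (e i - e j).

(** Weights between followers are symmetric, so the double sum may be averaged with its transpose.
    The result is a Dirichlet form, from which symmetry in [e] and [f] and nonnegativity can be read
    off. *)
Lemma laplacian_form (V : lmodType R) (B : V -> V -> R) (e f : 'I_N -> V) :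
  symbilin B ->
  \sum_i B (laplacian e i) (f i) = \sum_i a (L i) ord0 * B (e i) (f i) +
    2^-1 * \sum_i \sum_j a (L i) (L j) * B (e i - e j) (f i - f j).
Proof.
move=> hB; have [_ asym] := a_conn.
under eq_bigr do rewrite (bilDl hB) (bilZl hB) (bil_suml hB).
rewrite big_split /=; congr (_ + _).
under eq_bigr do under eq_bigr do rewrite (bilZl hB).
set T := (LHS); have TE : T = \sum_i \sum_j a (L i) (L j) * B (e j - e i) (f j).
  by rewrite /T exchange_big; apply: eq_bigr => i _; apply: eq_bigr => j _; rewrite asym.
have -> : T = 2^-1 * (T + T) by field.
congr (_ * _); rewrite {2}TE /T -big_split; apply: eq_bigr => i _.
rewrite -big_split; apply: eq_bigr => j _ /=.
by rewrite !(bilBl hB) !(bilBr hB); ring.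
Qed.

Lemma laplacian_form_ge0 (V : lmodType R) (B : V -> V -> R) (e : 'I_N -> V) :
  symbilin B -> (forall x, 0 <= B x x) -> 0 <= \sum_i B (laplacian e i) (e i).
Proof.
move=> hB B0; have [a0 _ _] := a_weights.
rewrite laplacian_form //; apply: addr_ge0.
  by apply: sumr_ge0 => i _; apply: mulr_ge0.
apply: mulr_ge0 => //; apply: sumr_ge0 => i _; apply: sumr_ge0 => j _.
exact: mulr_ge0.
Qed.

Lemma symbilin_mul : symbilin (fun x y : R^o => x * y).
Proof. by split=> [x y|k x y z]; [rewrite mulrC|rewrite mulrDl /GRing.scale /= mulrA]. Qed.

Definition laplacian_mx : 'M[R]_N := \matrix_(i, j)
  ((i == j)%:R * (\sum_k a (L i) k) - a (L i) (L j)).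

Lemma laplacian_mxE (x : 'cV[R]_N) i :
  (laplacian_mx *m x) i 0 = laplacian (fun i => x i 0 : R^o) i.
Proof.
rewrite mxE /laplacian; under eq_bigr do rewrite mxE mulrBl.
rewrite sumrB (_ : \sum_j (i == j)%:R * (\sum_k a (L i) k) * x j 0 = (\sum_k a (L i) k) * x i 0); last first.
  rewrite (bigD1 i) //= eqxx mul1r [X in _ + X]big1 ?addr0 // => j ji.
  by rewrite eq_sym (negbTE ji) !mul0r.
rewrite big_ord_recl mulrDl -addrA; congr (_ + _).
rewrite mulr_suml -sumrB; apply: eq_bigr => j _.
by rewrite -mulrBr.
Qed.

(** If the Dirichlet form vanishes, every edge term does, so the value 0 of the leader propagates
    along directed paths, and these reach every follower. *)
Lemma posdef_laplacian : posdef laplacian_mx.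
Proof.
have [a0 a_diag a_lead] := a_weights; have [conn asym] := a_conn.
split; first by apply/matrixP => i j; rewrite !mxE asym eq_sym; case: eqVneq => [->//|]; rewrite !mul0r.
move=> x x0.
have -> : (x^T *m laplacian_mx *m x) 0 0 =
  \sum_i laplacian (fun i => x i 0 : R^o) i * x i 0.
  by rewrite -mulmxA mxE; apply: eq_bigr => i _; rewrite laplacian_mxE mxE mulrC.
rewrite lt_neqAle (laplacian_form_ge0 _ symbilin_mul) ?andbT; last first.
  by move=> y; rewrite -expr2 sqr_ge0.
apply: contra_neq x0 => /esym.
rewrite (laplacian_form _ _ symbilin_mul) => S0.
have P1 : 0 <= \sum_i a (L i) ord0 * (x i 0 * x i 0).
  by apply: sumr_ge0 => i _; rewrite mulr_ge0 // -expr2 sqr_ge0.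
have P2 : 0 <= \sum_i \sum_j a (L i) (L j) * ((x i 0 - x j 0) * (x i 0 - x j 0)).
  by apply: sumr_ge0 => i _; apply: sumr_ge0 => j _; rewrite mulr_ge0 // -expr2 sqr_ge0.
have Z1 : \sum_i a (L i) ord0 * (x i 0 * x i 0) = 0 by move: S0 P1 P2; lra.
have Z2 : \sum_i \sum_j a (L i) (L j) * ((x i 0 - x j 0) * (x i 0 - x j 0)) = 0.
  by move: S0 P1 P2; lra.
pose y j := if unlift ord0 j is Some i then x i 0 else 0.
have edge (j k : 'I_N.+1) : 0 < a k j -> y j = 0 -> y k = 0.
  rewrite /y; case: (unliftP ord0 k) => [k' ->|-> //].
  case: (unliftP ord0 j) => [j' ->|->] akj yj.
    have sq i l : 0 <= a (L i) (L l) * ((x i 0 - x l 0) * (x i 0 - x l 0)).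
      by rewrite mulr_ge0 // -expr2 sqr_ge0.
    have Zk := psumr_eq0P (fun i _ => sumr_ge0 _ (fun l _ => sq i l)) Z2.
    have Zj := psumr_eq0P (fun l _ => sq k' l) (Zk k' isT).
    have /eqP := Zj j' isT.
    by rewrite mulf_eq0 gt_eqF //= yj subr0 mulf_eq0 orbb => /eqP.
  have sq i : 0 <= a (L i) ord0 * (x i 0 * x i 0).
    by rewrite mulr_ge0 // -expr2 sqr_ge0.
  have Zj := psumr_eq0P (fun i _ => sq i) Z1.
  have /eqP := Zj k' isT.
  by rewrite mulf_eq0 gt_eqF //= mulf_eq0 orbb => /eqP.
have y0 k : y k = 0.
  have /connectP[p + ->] := conn k.
  have : y ord0 = 0 by rewrite /y unlift_none.
  elim: p ord0 => //= j p IH i yi /andP[ij]; apply: IH.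
  exact: edge ij yi.
apply/colP => i; rewrite mxE.
by have := y0 (L i); rewrite /y liftK.
Qed.

Lemma laplacian_coercive : exists2 c, 0 < c & forall e : 'I_N -> R^o,
  c * \sum_i e i ^+ 2 <= \sum_i laplacian e i * e i.
Proof.
have [c c0 H] := posdef_coercive posdef_laplacian; exists c => // e.
have := H (\col_i e i); rewrite -dot_mulmx /dot.
under eq_bigr do rewrite !mxE -expr2.
move=> /le_trans; apply; rewrite le_eqVlt; apply/orP; left; apply/eqP.
apply: eq_bigr => i _; rewrite laplacian_mxE mxE mulrC; congr (_ * _).
rewrite /laplacian mxE; congr (_ + _); apply: eq_bigr => j _; by rewrite !mxE.
Qed.

(** Write p, q, r for [e.He], [|He|^2], [|e|^2]. Cauchy-Schwarz gives [p^2 <= q r], coercivity gives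
    [c r <= p], and together [c p <= q]. Thus [c^-1] stands in for the inverse of the least
    eigenvalue without any spectral decomposition. *)
Lemma laplacian_le_sqr : exists2 C, 0 < C & forall e : 'I_N -> R^o,
  \sum_i laplacian e i * e i <= C * \sum_i laplacian e i ^+ 2.
Proof.
have [c c0 H] := laplacian_coercive; exists c^-1; first by rewrite invr_gt0.
move=> e; rewrite ler_pdivlMl //.
have CS := bil_cauchy_schwarz (@symbilin_dot R N) (\col_i laplacian e i) (\col_i e i)
  (@dot_ge0 _ _).
have E1 : dot (\col_i laplacian e i) (\col_i e i) = \sum_i laplacian e i * e i.
  by apply: eq_bigr => i _; rewrite !mxE.
have E2 : dot (\col_i laplacian e i) (\col_i laplacian e i) = \sum_i laplacian e i ^+ 2.
  by apply: eq_bigr => i _; rewrite !mxE expr2.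
have E3 : dot (\col_i e i) (\col_i e i) = \sum_i e i ^+ 2.
  by apply: eq_bigr => i _; rewrite !mxE expr2.
move: CS (H e); rewrite E1 E2 E3; set p := \sum_i _ * _; set q := \sum_i _ ^+ 2.
set r := \sum_i _ ^+ 2 => pqr rp.
have q0 : 0 <= q by apply: sumr_ge0 => i _; exact: sqr_ge0.
have r0 : 0 <= r by apply: sumr_ge0 => i _; exact: sqr_ge0.
have [p0|p0] := leP p 0; first by apply: le_trans q0; rewrite pmulr_rle0.
rewrite -(ler_pM2r p0).
have : c * p ^+ 2 <= q * (c * r) by rewrite [leRHS]mulrCA ler_pM2l.
move=> /le_trans/(_ (ler_wpM2l q0 rp)); by rewrite expr2 mulrA.
Qed.

Lemma laplacian_dot_coercive n : exists2 c, 0 < c & forall e : 'I_N -> 'cV[R]_n,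
  c * \sum_i dot (e i) (e i) <= \sum_i dot (laplacian e i) (e i).
Proof.
have [c c0 H] := laplacian_coercive; exists c => // e.
rewrite /dot exchange_big [leRHS]exchange_big mulr_sumr; apply: ler_sum => k _ /=.
have := H (fun i => e i k 0); congr (_ * _ <= _).
apply: eq_bigr => i _; congr (_ * _); rewrite /laplacian !mxE summxE; congr (_ + _).
by apply: eq_bigr => j _; rewrite !mxE.
Qed.

(** [M] minus a small multiple of the identity is still positive semidefinite, so its Laplacian form
    is nonnegative; this reduces a general [M] to the identity. *)
Lemma laplacian_posdef_coercive n (M : 'M[R]_n) : posdef M ->
  exists2 c, 0 < c & forall e : 'I_N -> 'cV[R]_n,
  c * \sum_i dot (e i) (e i) <= \sum_i qform M (laplacian e i) (e i).
Proof.
move=> Mpos; have [c c0 Hc] := posdef_coercive Mpos.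
have [d d0 Hd] := laplacian_dot_coercive n.
exists (c * d); first exact: mulr_gt0.
move=> e; rewrite -mulrA; apply: le_trans (_ : c * \sum_i dot (laplacian e i) (e i) <= _).
  by rewrite ler_pM2l.
have [hM1 hM2] := symbilin_qform Mpos.1; have [hD1 hD2] := @symbilin_dot R n.
have hB : symbilin (fun x y => qform M x y - c * dot x y).
  split=> [x y|k x y z]; first by rewrite hM1 hD1.
  by rewrite hM2 hD2; ring.
have := laplacian_form_ge0 e hB; rewrite sumrB -mulr_sumr subr_ge0; apply.
by move=> x; rewrite subr_ge0.
Qed.

End graph.

(** * Quadratic Lyapunov functions of Hurwitz matrices *)

Section definite_forms.
Context (R : realType) (m : nat).

Lemma bil_coercive (B : 'cV[R]_m -> 'cV[R]_m -> R) : symbilin B ->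
  (forall x, x != 0 -> 0 < B x x) ->
  exists2 c, 0 < c & forall x, c * dot x x <= B x x.
Proof.
move=> hB Bpos; pose M : 'M[R]_m := \matrix_(i, j) B (delta_mx i 0) (delta_mx j 0).
have ME x y : qform M x y = B x y.
  rewrite /qform -mulmxA mxE [x in RHS]col_sum_delta (bil_suml hB).
  apply: eq_bigr => i _; rewrite mxE (bilZl hB) [y in RHS]col_sum_delta (bil_sumr hB).
  congr (_ * _); rewrite mxE; apply: eq_bigr => j _.
  by rewrite mxE (bilZr hB) mulrC.
have [|c c0 H] := @posdef_coercive _ _ M; last by exists c => // x; rewrite -ME.
split; first by apply/matrixP => i j; rewrite !mxE (bilC hB).
by move=> x x0; have := Bpos x x0; rewrite -ME.
Qed.

End definite_forms.

Section lyapunov.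
Context (R : realType).
Local Notation C := (R[i]).
Local Notation Re := complex.Re.
Local Notation Im := complex.Im.

(** The real part of conj(u) v, that is, the scalar product of the plane. *)
Let ip (u v : C) : R := Re u * Re v + Im u * Im v.

Let ipDr (u v w : C) : ip u (v + w) = ip u v + ip u w.
Proof. by case: u v w => [a b] [c d] [e f]; rewrite /ip /=; ring. Qed.

Let ip0r (u : C) : ip u 0 = 0.
Proof. by rewrite /ip !mulr0 addr0. Qed.

Let ip_ge0 u : 0 <= ip u u.
Proof. by rewrite /ip -!expr2 addr_ge0 ?sqr_ge0. Qed.

Let ip_self_mul (u t : C) : ip u (t * u) = Re t * ip u u.
Proof. by case: u t => [a b] [c d]; rewrite /ip /=; ring. Qed.

Let ip_mul (t u : C) : ip (t * u) (t * u) = ip t t * ip u u.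
Proof. by case: u t => [a b] [c d]; rewrite /ip /=; ring. Qed.

Let ip_young u v (s : R) k : 0 < s ->
  k * ip u v <= s * ip u u + k ^+ 2 / (4 * s) * ip v v.
Proof.
move=> s0; rewrite -subr_ge0.
have -> : s * ip u u + k ^+ 2 / (4 * s) * ip v v - k * ip u v =
  ((2 * s * Re u - k * Re v) ^+ 2 + (2 * s * Im u - k * Im v) ^+ 2) / (4 * s).
  by rewrite /ip; field; lra.
by rewrite divr_ge0 ?addr_ge0 ?sqr_ge0 // mulr_ge0 // ltW.
Qed.

(** [T] is lower triangular, so its first [k] rows involve only the first [k] coordinates and one
    coordinate can be added at a time. The new diagonal term gives [-2 |y_o|^2]. Half of it pays, by
    Young's inequality, for the cross terms up to [K * S], and multiplying the old weights by
    [K + 1] pays for [K * S]. *)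
Lemma triangular_lyapunov n (T : 'M[C]_n) : is_trig_mx T ->
  (forall i, Re (T i i) < 0) -> forall k : nat, (k <= n)%N ->
  exists2 c : 'I_n -> R, forall i, 0 < c i & forall y : 'cV[C]_n,
    \sum_(i < n | (i < k)%N) c i * ip (y i 0) ((T *m y) i 0) <=
    - \sum_(i < n | (i < k)%N) ip (y i 0) (y i 0).
Proof.
move=> /is_trig_mxP trT Tneg; elim=> [_|k IH kn].
  by exists (fun=> 1) => // y; rewrite !big_pred0 // oppr0.
have [c c0 Hc] := IH (ltnW kn).
pose o := Ordinal kn.
have n0 : 0 < n%:R :> R by rewrite ltr0n; exact: leq_ltn_trans (leq0n k) kn.
(* Each of the at most [n] cross terms may spend the fraction [1/n] of [|y_o|^2]. *)
pose s : R := n%:R^-1.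
have s0 : 0 < s by rewrite invr_gt0.
pose ck := - (2 / Re (T o o)).
have ck0 : 0 < ck by rewrite oppr_gt0 pmulr_rlt0 // invr_lt0.
pose K := \sum_(j < n | (j < k)%N) ck ^+ 2 / (4 * s) * ip (T o j) (T o j).
have K0 : 0 <= K.
  by apply: sumr_ge0 => j _; rewrite mulr_ge0 // divr_ge0 ?sqr_ge0 // mulr_ge0 // ltW.
exists (fun i : 'I_n => if (i < k)%N then (K + 1) * c i else ck).
  by move=> i; case: ifP => // _; rewrite mulr_gt0 // ltr_wpDl.
have split (F : 'I_n -> R) : \sum_(i < n | (i < k.+1)%N) F i = F o + \sum_(i < n | (i < k)%N) F i :> R.
  rewrite (bigD1 o) //=; congr (_ + _); apply: eq_bigl => i.
  by rewrite ltnS -val_eqE /= ltn_neqAle andbC.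
move=> y; rewrite !split /= ltnn.
set S := \sum_(i < n | (i < k)%N) ip _ _.
have -> : \sum_(i < n | (i < k)%N) (if (i < k)%N then (K + 1) * c i else ck) *
    ip (y i 0) ((T *m y) i 0) =
  (K + 1) * \sum_(i < n | (i < k)%N) c i * ip (y i 0) ((T *m y) i 0).
  by rewrite mulr_sumr; apply: eq_bigr => i ->; rewrite mulrA.
have S0 : 0 <= S by apply: sumr_ge0.
have {Hc} Hc : (K + 1) * (\sum_(i < n | (i < k)%N) c i * ip (y i 0) ((T *m y) i 0)) <=
    (K + 1) * (- S) by rewrite ler_wpM2l ?Hc //; lra.
have TyE : (T *m y) o 0 = T o o * y o 0 + \sum_(j < n | (j < k)%N) T o j * y j 0.
  rewrite mxE (bigID (fun j : 'I_n => (j < k.+1)%N)) /= [X in _ + X]big1 ?addr0; last first.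
    by move=> j; rewrite -leqNgt => kj; rewrite trT // mul0r.
  rewrite (bigD1 o) //=; congr (_ + _); apply: eq_bigl => i.
  by rewrite ltnS -val_eqE /= ltn_neqAle andbC.
have cross : ck * ip (y o 0) (\sum_(j < n | (j < k)%N) T o j * y j 0) <=
    ip (y o 0) (y o 0) + K * S.
  rewrite (big_morph _ (ipDr (y o 0)) (ip0r (y o 0))) mulr_sumr.
  apply: (@le_trans _ _ (\sum_(j < n | (j < k)%N) (s * ip (y o 0) (y o 0) +
     (ck ^+ 2 / (4 * s) * ip (T o j) (T o j)) * S))).
    apply: ler_sum => j jk; apply: le_trans (ip_young _ _ _ s0) _.
    rewrite lerD2l ip_mul mulrA; apply: ler_wpM2l.
      by rewrite mulr_ge0 // divr_ge0 ?sqr_ge0 // mulr_ge0 // ltW.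
    by rewrite /S (bigD1 j) //= lerDl; apply: sumr_ge0.
  rewrite big_split /= -!mulr_suml lerD2r.
  rewrite -[leRHS]mul1r; apply: ler_wpM2r => //.
  apply: (@le_trans _ _ (\sum_(j < n) s)).
    by rewrite big_mkcond; apply: ler_sum => j _; case: ifP => // _; rewrite ltW.
  by rewrite sumr_const card_ord -mulr_natl mulfV ?gt_eqF.
rewrite TyE ipDr ip_self_mul.
have : ck * (Re (T o o) * ip (y o 0) (y o 0)) = - 2 * ip (y o 0) (y o 0).
  by rewrite /ck; field; rewrite lt_eqF // Tneg.
lra.
Qed.

(* In coordinates that triangularize A over the complex numbers a suitably
   weighted sum of squared moduli decreases. *)
Lemma hurwitz_lyapunov n (A : 'M[R]_n) : hurwitz A ->
  exists B : 'cV[R]_n -> 'cV[R]_n -> R, [/\ symbilin B,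
    (exists2 c, 0 < c & forall x, c * dot x x <= B x x) &
    forall x, 2 * B x (A *m x) <= - dot x x].
Proof.
case: n A => [|n] A Ahur.
  exists (@dot R 0); split; first exact: symbilin_dot.
    by exists 1 => // x; rewrite mul1r.
  by move=> x; rewrite /dot !big_ord0 mulr0 oppr0.
pose Ac : 'M[C]_n.+1 := map_mx (real_complex R) A.
have [P /unitarymx_unit Pu] := Schur Ac (ltn0Sn n).

have : conjmx P Ac *m P = P *m Ac by rewrite conjumx // mulmxKV.
move=> TE; move: TE; set T := conjmx P Ac => TE. rewrite -/T => Ttr.
have Tneg i : Re (T i i) < 0.
  apply: Ahur; rewrite -/Ac.
  have /eigenvalueP[v vT v0] : eigenvalue T (T i i).
    rewrite eigenvalue_root_char char_poly_trig // /root horner_prod.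
    by rewrite (bigD1 i) //= !hornerE subrr mul0r.
  apply/eigenvalueP; exists (v *m P); first by rewrite -mulmxA -TE mulmxA vT scalemxAl.
  by apply: contraNneq v0 => vP; rewrite -[v](mulmxK Pu) vP mul0mx.
have [c c0 Hc] := triangular_lyapunov Ttr Tneg (leqnn _).
pose Y (x : 'cV[R]_n.+1) : 'cV[C]_n.+1 := P *m map_mx (real_complex R) x.
have YP k x y : Y (k *: x + y) = real_complex R k *: Y x + Y y.
  rewrite /Y map_mxD map_mxZ mulmxDr -scalemxAr //.
have form (w : 'I_n.+1 -> R) : symbilin (fun x y => \sum_i w i * ip (Y x i 0) (Y y i 0)).
  split=> [x y|k x y z].
    by apply: eq_bigr => i _; rewrite /ip; ring.
  rewrite mulr_sumr -big_split; apply: eq_bigr => i _ /=; rewrite YP.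
  have -> : (real_complex R k *: Y x + Y y) i 0 = real_complex R k * Y x i 0 + Y y i 0.
    by rewrite [LHS]mxE; congr (_ + _); rewrite [LHS]mxE.
  case: (Y x i 0) => a b; case: (Y y i 0) => a' b'; rewrite /ip /=.  ring.
have fpos (w : 'I_n.+1 -> R) : (forall i, 0 < w i) -> forall x, x != 0 ->
    0 < \sum_i w i * ip (Y x i 0) (Y x i 0).
  move=> w0 x x0; have h0 i : 0 <= w i * ip (Y x i 0) (Y x i 0).
    by rewrite mulr_ge0 // ltW.
  rewrite lt_neqAle sumr_ge0 // andbT; apply: contra_neq x0 => /esym S0.
  have Z := psumr_eq0P (fun i _ => h0 i) S0.
  have Y0 : Y x = 0.
    apply/colP => i; have /eqP := Z i isT; rewrite mulf_eq0 gt_eqF //= [RHS]mxE.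
    rewrite paddr_eq0 -?expr2 ?sqr_ge0 // !sqrf_eq0.
    by case: (Y x i 0) => a b /= /andP[/eqP-> /eqP->].
  have : map_mx (real_complex R) x = 0 by rewrite -[LHS](mulKmx Pu) -/(Y x) Y0 mulmx0.
  move=> /matrixP x0; apply/colP => i; have := x0 i 0; rewrite !mxE.
  by move=> [].
(* [d] compares the squared modulus of [Y x] with [dot x x]; dividing the weights by it states the
   decay in the original coordinates. *)
have [d d0 Hd] := bil_coercive (form (fun=> 1)) (fpos _ (fun=> ltr01)).
have dc0 i : 0 < c i / d by rewrite divr_gt0.
exists (fun x y => \sum_i c i / d * ip (Y x i 0) (Y y i 0)).
split; [exact: form|exact: bil_coercive (form _) (fpos _ dc0)|].
move=> x; have YA : Y (A *m x) = T *m Y x by rewrite /Y map_mxM mulmxA -TE -mulmxA.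
have allE (F : 'I_n.+1 -> R) : \sum_(i < n.+1 | (i < n.+1)%N) F i = \sum_i F i.
  by apply: eq_bigl => i; rewrite ltn_ord.
have := Hc (Y x); rewrite YA !allE.
have := Hd x; under eq_bigr do rewrite mul1r.
set S := \sum_i _ => H1; set S2 := \sum_i _ => H2.
have -> : \sum_i c i / d * ip (Y x i 0) ((T *m Y x) i 0) = S2 / d.
  by rewrite /S2 mulr_suml; apply: eq_bigr => i _; rewrite mulrAC.
have x0 := dot_ge0 x.
have : S2 / d <= - dot x x by rewrite ler_pdivrMr //; lra.
lra.
Qed.

End lyapunov.

(** * Quadratic forms along Filippov solutions *)

Section continuity.
Context (R : realType).

Lemma cvg_sumr {T : Type} (G : set_system T) {FG : Filter G} (I : Type) (r : seq I)
    (P : pred I) (f : I -> T -> R) (l : I -> R) :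
  (forall i, P i -> f i x @[x --> G] --> l i) ->
  \sum_(i <- r | P i) f i x @[x --> G] --> \sum_(i <- r | P i) l i.
Proof.
move=> fl; elim: r => [|i r IH].
  by rewrite big_nil; under eq_cvg do rewrite big_nil; exact: cvg_cst.
rewrite big_cons; under eq_cvg do rewrite big_cons.
by case: ifP => // Pi; apply: cvgD => //; exact: fl.
Qed.

Lemma cvg_mx {T : Type} (G : set_system T) {FG : Filter G} m n (f : T -> 'M[R]_(m, n))
    (l : 'M[R]_(m, n)) :
  (forall i j, f x i j @[x --> G] --> l i j) -> f x @[x --> G] --> l.
Proof.
move=> fl; apply/cvgrPdist_le => /= e e0; near=> x.
rewrite /Num.Def.normr/= mx_normrE (bigmax_le _ (ltW e0))//= => i _.
rewrite !mxE/=; move: i; near: x; apply: filter_forall => /= i.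
exact: ((cvgrPdist_le _ _).1 (fl i.1 i.2)).
Unshelve. all: by end_near. Qed.

Lemma cvg_coord {T : Type} (G : set_system T) {FG : Filter G} m n (f : T -> 'M[R]_(m, n))
    (l : 'M[R]_(m, n)) i j :
  f x @[x --> G] --> l -> f x i j @[x --> G] --> l i j.
Proof.
move=> fl; apply: (@cvg_comp _ _ _ f (fun M => M i j) _ _ _ fl).
exact: (@coord_continuous R m n i j l).
Qed.

Lemma cvg_dist {T : Type} (G : set_system T) {FG : Filter G} (f : T -> R) (l c : R) :
  f x @[x --> G] --> l -> `|c - f x| @[x --> G] --> `|c - l|.
Proof. by move=> fl; apply: cvg_norm; apply: cvgB => //; exact: cvg_cst. Qed.

Definition scalin (V : lmodType R) (l : V -> R) : Prop :=
  forall k x y, l (k *: x + y) = k * l x + l y.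

Lemma scalin_expand m (l : 'cV[R]_m -> R) x : scalin l ->
  l x = \sum_i x i 0 * l (delta_mx i 0).
Proof.
move=> hl; have hB : symbilin (fun x y => l x * l y).
  by split=> [? ?|k u v w]; [rewrite mulrC|rewrite hl; ring].
have l0 : l 0 = 0.
  by have := hl 1 0 0; rewrite scaler0 addr0 mul1r => /(congr1 (fun u => u - l 0)); rewrite subrr addrK.
have lD : {morph l : u v / u + v}.
  by move=> u v; have := hl 1 u v; rewrite scale1r mul1r.
rewrite {1}[x]col_sum_delta (big_morph l lD l0); apply: eq_bigr => i _.
by have := hl (x i 0) (delta_mx i 0) 0; rewrite l0 !addr0.
Qed.

Lemma cvg_scalin {T : Type} (G : set_system T) {FG : Filter G} m (l : 'cV[R]_m -> R)
    (f : T -> 'cV[R]_m) z :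
  scalin l -> f x @[x --> G] --> z -> l (f x) @[x --> G] --> l z.
Proof.
move=> hl fz; rewrite (scalin_expand z hl).
under eq_cvg do rewrite (scalin_expand _ hl).
apply: cvg_sumr => i _; apply: cvgMr_tmp; exact: cvg_coord.
Qed.

Lemma continuous_scalin m (l : 'cV[R]_m -> R) : scalin l -> continuous l.
Proof.
move=> hl z; apply: (@cvg_scalin _ (nbhs z) (nbhs_filter z) m l id z) => //.
Qed.

Lemma symbilin_scalin (V : lmodType R) (B : V -> V -> R) x : symbilin B -> scalin (B x).
Proof. by move=> hB k y z; rewrite (bilDr hB) (bilZr hB). Qed.

Lemma cvg_bil {T : Type} (G : set_system T) {FG : Filter G} m
    (B : 'cV[R]_m -> 'cV[R]_m -> R) (f g : T -> 'cV[R]_m) u v :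
  symbilin B -> f x @[x --> G] --> u -> g x @[x --> G] --> v ->
  B (f x) (g x) @[x --> G] --> B u v.
Proof.
move=> hB fu gv; have E x y : B x y = \sum_i x i 0 * B (delta_mx i 0) y.
  by rewrite (bilC hB) (scalin_expand x (symbilin_scalin y hB));
    apply: eq_bigr => i _; rewrite (bilC hB).
rewrite E; under eq_cvg do rewrite E.
apply: cvg_sumr => i _; apply: cvgM; first exact: cvg_coord.
exact: cvg_scalin (symbilin_scalin _ hB) gv.
Qed.

End continuity.

(** * Linear functionals on Filippov sets and increments along solutions *)

Section filippov_lemmas.
Context (R : realType) (m : nat) (m_gt0 : (0 < m)%N).
Local Notation mu := (@lebesgue_measure R).

(** Degenerate boxes have volume 0 only in positive dimension: in dimension 0 the empty product
    gives every box volume 1. *)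
Lemma null_set0 : Defs.null_set (set0 : set 'cV[R]_m).
Proof.
move=> e e0; exists (fun=> 0), (fun=> 0); split => //.
rewrite eseries0 ?lee_fin ?ltW // => i _ _.
by rewrite (bigD1 (Ordinal m_gt0)) //= mxE subrr mul0r.
Qed.

(** The set where [l] differs from [l (F z t)] by at most [e] is a closed convex slab. It contains
    the image of a small ball, hence the closed convex hull for the empty exceptional set, hence
    [Y]; then [e] tends to 0. *)
Lemma filippov_scalin (F : 'cV[R]_m -> R -> 'cV[R]_m) z t Y (l : 'cV[R]_m -> R) :
  scalin l -> l (F x t) @[x --> z] --> l (F z t) -> filippov F z t Y ->
  l Y = l (F z t).
Proof.
move=> hl lF FY; apply/eqP; rewrite eq_sym -subr_eq0 -normr_eq0 eq_le normr_ge0 andbT.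
apply/ler_addgt0Pl => e e0; rewrite addr0.
move/cvgrPdist_le : lF => /(_ e e0) lF.
have [d /= d0 Hd] := (nbhs_ballP _ _).1 lF.
have := FY d d0 set0 null_set0; rewrite setD0 => /(_ [set y | `|l (F z t) - l y| <= e]).
apply; split; last first.
  move=> y [x /= xz <-]; apply: Hd => /=.
  (* The neighbourhood filter yields a ball for the max norm, which contains the Euclidean ball of
     the same radius. *)
  rewrite mx_norm_ball /ball_ /= /Num.Def.normr/= mx_normrE.
  apply: bigmax_lt => // -[i j] _ /=; rewrite !mxE distrC ord1.
  by apply: le_lt_trans xz; have := coord_le_enorm (x - z) i; rewrite !mxE.
split.
  have cl := continuous_scalin hl.
  have cg : continuous (fun y => `|l (F z t) - l y|).
    by move=> x; exact: (@cvg_dist _ _ (nbhs x) (nbhs_filter x) _ _ _ (cl x)).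
  have := @preimage_closed _ _ _ [set r | r <= e] (fun x _ => cg x) (@closed_le R e).
  exact.
move=> x y k; rewrite !inE /= => Hx Hy.
have lZ q u : l (q *: u) = q * l u.
  have := hl q u 0; have := hl 1 0 0; rewrite scaler0 !addr0 mul1r; lra.
rewrite /conv /= hl lZ.
have k0 : 0 <= k%:num by [].
have k1 : k%:num <= 1 by [].
have -> : l (F z t) - (k%:num * l x + unstable.onem k%:num * l y) =
  k%:num * (l (F z t) - l x) + (1 - k%:num) * (l (F z t) - l y) by rewrite /unstable.onem; ring.
apply: le_trans (ler_normD _ _) _; rewrite !normrM (ger0_norm k0) (@ger0_norm _ (1 - _)) ?subr_ge0 //.
have := ler_wpM2l k0 Hx; have := ler_wpM2l (_ : 0 <= 1 - k%:num) Hy.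
rewrite subr_ge0 => /(_ k1); lra.
Qed.

Lemma enormD (x y : 'cV[R]_m) : enorm (x + y) <= enorm x + enorm y.
Proof.
have hd := @symbilin_dot R m.
rewrite -(ler_pXn2r (ltn0Sn 1)) ?nnegrE ?addr_ge0 ?enorm_ge0 // sqrrD !enorm_sqr.
rewrite (bilDl hd) !(bilDr hd) (bilC hd y x).
have : dot x y <= enorm x * enorm y.
  apply: le_trans (ler_norm _) _.
  rewrite -(ler_pXn2r (ltn0Sn 1)) ?nnegrE ?mulr_ge0 ?enorm_ge0 // exprMn !enorm_sqr.
  rewrite real_normK ?num_real //; exact: bil_cauchy_schwarz (@dot_ge0 _ _).
rewrite mulr2n; lra.
Qed.

(** A step in time shorter than [d] moves [X] by less than 1, and finitely many steps of length
    [d / 2] exhaust the interval. *)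
Lemma abs_continuous_bounded (t0 t1 : R) (X : R -> 'cV[R]_m) :
  abs_continuous t0 t1 X -> exists2 C, 0 <= C & forall t, t0 <= t <= t1 -> enorm (X t) <= C.
Proof.
move=> /(_ 1 ltr01)[d d0 acX].
have H n t : t0 <= t <= t1 -> t <= t0 + n%:R * (d / 2) -> enorm (X t) <= enorm (X t0) + n%:R.
  elim: n t => [|n IH] t tt tn.
    have -> : t = t0 by move: tn; rewrite mul0r; lra.
    by rewrite addr0.
  pose s := Num.max t0 (t - d / 2).
  have st : s <= t by rewrite /s ge_max; lra.
  have ts : t0 <= s by rewrite /s le_max lexx.
  have sd : t - s < d.
    have : t - d / 2 <= s by rewrite /s le_max lexx orbT.
    lra.
  have sn : enorm (X s) <= enorm (X t0) + n%:R.
    apply: IH; first by lra.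
    rewrite /s ge_max lerDl mulr_ge0 //=; last lra.
    by move: tn; rewrite -natr1; lra.
  have := acX 1%N (fun=> s) (fun=> t); rewrite !big_ord1 => /(_ _ _ sd) H.
  have {}H : enorm (X t - X s) < 1.
    by apply: H => [_|i j]; [split; lra|rewrite !ord1 eqxx].
  have := enormD (X t - X s) (X s); rewrite subrK -natr1; lra.
have [n tn] : exists n : nat, t1 <= t0 + n%:R * (d / 2).
  exists (Num.truncn (`|t1 - t0| / (d / 2))).+1.
  have : `|t1 - t0| / (d / 2) < (Num.truncn (`|t1 - t0| / (d / 2))).+1%:R by exact: truncnS_gt.
  by rewrite ltr_pdivrMr; last lra; have := ler_norm (t1 - t0); lra.
exists (enorm (X t0) + n%:R); first by rewrite addr_ge0 // enorm_ge0.
by move=> t tt; apply: H => //; lra.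
Qed.

Lemma ac_of_lipschitz (t0 t1 a b C : R) (X : R -> 'cV[R]_m) (f : R -> R) :
  abs_continuous t0 t1 X -> t0 <= a -> b <= t1 -> 0 <= C ->
  (forall u v, a <= u -> u <= v -> v <= b -> `|f v - f u| <= C * enorm (X v - X u)) ->
  ac_on a b f.
Proof.
move=> acX ta bt C0 fX e e0; have [|d d0 H] := acX (e / (C + 1)); first by rewrite divr_gt0 //; lra.
exists d => // k u v uv dis sd.
have {H} : \sum_(i < k) enorm (X (v i) - X (u i)) < e / (C + 1).
  by apply: H => // i; have [? ? ?] := uv i; split; lra.
rewrite ltr_pdivlMr; last lra.
set S := \sum_(i < k) enorm _ => HS.
have S0 : 0 <= S by apply: sumr_ge0 => i _; exact: enorm_ge0.
apply: le_lt_trans (_ : C * S < e); last by lra.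
rewrite mulr_sumr; apply: ler_sum => i _; have [? ? ?] := uv i; exact: fX.
Qed.

Section quadratic_along_solutions.
Context (F : 'cV[R]_m -> R -> 'cV[R]_m) (B : 'cV[R]_m -> 'cV[R]_m -> R) (c : 'cV[R]_m).
Hypothesis hB : symbilin B.
Hypothesis BF : forall z t, B (z - c) (F x t) @[x --> z] --> B (z - c) (F z t).
Context (t0 t1 : R) (X : R -> 'cV[R]_m).
Hypothesis solX : filippov_solution F t0 t1 X.
Let q t := B (X t - c) (X t - c).

(** A difference of two squares factors through [X v - X u] and [X v + X u - 2 c], and the second
    factor is bounded on the interval. Absolute continuity thus passes from [X] to [q]. *)
Lemma quad_lipschitz : exists2 C, 0 <= C & forall u v, t0 <= u <= t1 -> t0 <= v <= t1 ->
  `|q v - q u| <= C * enorm (X v - X u).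
Proof.
have [C C0 HC] := bil_bounded hB; have [K K0 HK] := abs_continuous_bounded solX.1.
exists (C * (K + K + enorm (- c - c))); first by rewrite mulr_ge0 ?addr_ge0 ?enorm_ge0.
move=> u v tu tv.
have -> : q v - q u = B (X v - X u) ((X v + X u) + (- c - c)).
  rewrite /q !(bilDr hB, bilDl hB, bilNl hB, bilNr hB).
  rewrite (bilC hB (X u) (X v)) (bilC hB c (X u)) (bilC hB c (X v)); ring.
apply: le_trans (HC _ _) _; rewrite -mulrA ler_wpM2l // mulrC ler_wpM2r ?enorm_ge0 //.
apply: le_trans (enormD _ _) _; rewrite lerD2r.
by apply: le_trans (enormD _ _) _; rewrite lerD ?HK.
Qed.

(** The same factorization is applied to the difference quotient. The velocity is only known to lie
    in the Filippov set, but the functional [B (X t - c)] takes a single value there, the one at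
    [F (X t) t]. *)
Lemma quad_derive : {ae mu, forall t, t0 <= t <= t1 ->
  is_derive t 1 q (2 * B (X t - c) (F (X t) t))}.
Proof.
case: (solX.2) => M [mM M0 EM]; exists M; split => // t /= nt; apply: EM => /= H.
apply: nt => /H [dX FY].
rewrite -(filippov_scalin (symbilin_scalin (X t - c) hB) (@BF (X t) t) FY).
suff qd : h^-1 *: (q (h *: 1 + t) - q t) @[h --> 0^'] --> 2 * B (X t - c) ('D_1 X t).
  by split; [apply/cvg_ex; eexists; exact: qd|exact/cvg_lim].
have E h : h^-1 *: (q (h *: 1 + t) - q t) =
    B (h^-1 *: (X (h *: 1 + t) - X t)) (X (h *: 1 + t) + X t - (c + c)).
  rewrite /q (bilZl hB) /GRing.scale /=; congr (_ * _).
  set x := X _; set y := X t.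
  rewrite !(bilDr hB, bilDl hB, bilNl hB, bilNr hB) (bilC hB y x) (bilC hB c x) (bilC hB c y); ring.
under eq_cvg do rewrite E.
have -> : 2 * B (X t - c) ('D_1 X t) = B ('D_1 X t) (X t + X t - (c + c)).
  by rewrite (bilC hB) !(bilDr hB, bilNr hB); ring.
apply: (cvg_bil hB); first exact: dX.
apply: cvgB; last exact: cvg_cst.
apply: cvgD; last exact: cvg_cst.
have /derivable1_diffP/differentiable_continuous cX := dX.
have ht : h *: 1 + t @[h --> (0 : R)^'] --> 0 *: 1 + t.
  apply: cvgD; last exact: cvg_cst.
  by apply: cvgZr_tmp; exact: cvg_within.
rewrite scale0r add0r in ht.
apply: (@cvg_comp _ _ _ (fun h : R => h *: 1 + t) X _ _ _ ht cX).
Qed.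

Lemma quad_increment_le a b k : t0 <= a -> a <= b -> b <= t1 ->
  (forall t, a <= t <= b -> 2 * B (X t - c) (F (X t) t) <= k) ->
  q b - q a <= k * (b - a).
Proof.
move=> ta ab bt Hk; have [C C0 HC] := quad_lipschitz.
apply: ac_derive_le => //.
  apply: (ac_of_lipschitz solX.1 ta bt C0) => u v au uv vb.
  by apply: HC; lra.
case: quad_derive => M [mM M0 EM]; exists M; split => // t /= nt; apply: EM => /= H.
apply: nt => tab; exists (2 * B (X t - c) (F (X t) t)); first exact: Hk.
by apply: H; lra.
Qed.

Lemma ln_lipschitz (x y : R) : 0 <= x -> 0 <= y -> `|ln (1 + y) - ln (1 + x)| <= `|y - x|.
Proof.
have H (u v : R) : 0 <= u -> u <= v -> ln (1 + v) - ln (1 + u) <= v - u.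
  move=> u0 uv; rewrite -ln_div ?posrE; [|lra..].
  have -> : (1 + v) / (1 + u) = 1 + (v - u) / (1 + u) by field; lra.
  apply: le_trans (le_ln1Dx _) _.
    have : 0 <= (v - u) / (1 + u) by apply: divr_ge0; lra.
    lra.
  rewrite ler_pdivrMr; [nra|lra].
have M (u v : R) : 0 <= u -> u <= v -> ln (1 + u) <= ln (1 + v).
  by move=> u0 uv; rewrite ler_ln ?posrE; [|lra..]; lra.
move=> x0 y0; case: (lerP x y) => xy.
  by have := H _ _ x0 xy; have := M _ _ x0 xy => ? ?; rewrite !ger0_norm; lra.
have := H _ _ y0 (ltW xy); have := M _ _ y0 (ltW xy) => ? ?.
by rewrite !ler0_norm; lra.
Qed.

(** Gronwall's inequality through the logarithm: [1 + q] is at least 1, where [ln] is 1-Lipschitz,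
    so [ln (1 + q)] is absolutely continuous with derivative at most [k]. *)
Lemma quad_gronwall a b k : t0 <= a -> a <= b -> b <= t1 -> (forall x, 0 <= B x x) ->
  (forall t, a <= t <= b -> 2 * B (X t - c) (F (X t) t) <= k * (1 + q t)) ->
  ln (1 + q b) - ln (1 + q a) <= k * (b - a).
Proof.
move=> ta ab bt B0 Hk; have [C C0 HC] := quad_lipschitz.
apply: (@ac_derive_le _ a b k (fun t => ln (1 + q t))) => //.
  apply: (ac_of_lipschitz solX.1 ta bt C0) => u v au uv vb.
  apply: le_trans (HC u v ltac:(lra) ltac:(lra)).
  by apply: ln_lipschitz; exact: B0.
case: quad_derive => M [mM M0 EM]; exists M; split => // t /= nt; apply: EM => /= H.
apply: nt => tab; have q0 : 0 < 1 + q t by rewrite ltr_pwDl ?B0.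
exists ((1 + q t)^-1 * (2 * B (X t - c) (F (X t) t))).
  by rewrite mulrC ler_pdivrMr // Hk.
have dq := H ltac:(lra).
have d1 : is_derive t 1 (fun t => 1 + q t) (2 * B (X t - c) (F (X t) t)).
  have -> : (fun t => 1 + q t) = cst 1 + q by [].
  by apply: is_derive_eq; rewrite add0r.
have dl := is_derive1_ln q0.
exact: (@is_derive1_comp R (@ln R) (fun t => 1 + q t) t _ _ dl d1).
Qed.

End quadratic_along_solutions.

End filippov_lemmas.

(** A form of Barbalat's lemma. After [T] the value of [V] lies within [d] of its infimum, whereas a
    value of [W] above [e] would persist above [e / 2] long enough to make [V] lose [d]. *)
Lemma decay_to_zero (R : realType) (t0 c K : R) (V W : R -> R) :
  0 < c -> 0 < K -> (forall t, t0 <= t -> 0 <= V t) -> (forall t, t0 <= t -> 0 <= W t) ->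
  (forall a b, t0 <= a -> a <= b -> W a - W b <= K * (b - a)) ->
  (forall a b r, t0 <= a -> a <= b -> (forall t, a <= t <= b -> r <= W t) ->
     V b - V a <= - (c * r) * (b - a)) ->
  W t @[t --> +oo] --> 0.
Proof.
move=> c0 K0 V0 W0 WL VW.
pose S := [set V t | t in [set t | t0 <= t]].
have hS : has_inf S by split; [exists (V t0), t0 => //=|exists 0 => _ [t /= tt <-]; exact: V0].
apply/cvgrPdist_le => e e0.
(* At rate at most [K], [W] needs at least the time [h] to fall from [e] to [e / 2]; [d] is the loss
   of [V] in that time. *)
pose h := e / (2 * K).
have h0 : 0 < h by rewrite divr_gt0 // mulr_gt0.
pose d := c * (e / 2) * h.
have d0 : 0 < d by rewrite /d mulr_gt0 // mulr_gt0 // divr_gt0.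
have [_ [T /= tT <-] VT] := inf_adherent d0 hS.
near=> t.
have Tt : T <= t by near: t; apply: nbhs_pinfty_ge; rewrite num_real.
have tt : t0 <= t by lra.
rewrite sub0r normrN ger0_norm ?W0 // leNgt; apply/negP => We.
have Vt : V t <= V T.
  by have := VW T t 0 tT Tt; rewrite mulr0 oppr0 mul0r subr_le0; apply => s ?; apply: W0; lra.
have := VW t (t + h) (e / 2) tt ltac:(lra).
have -> : t + h - t = h by ring.
have /[swap]/[apply] : forall s, t <= s <= t + h -> e / 2 <= W s.
  move=> s /andP[ts sh]; have := WL t s tt ts.
  have : K * (s - t) <= K * h by rewrite ler_pM2l //; lra.
  have : K * h = e / 2 by rewrite /h; field; lra.
  lra.
have : inf S <= V (t + h).
  by apply: ge_inf; [case: hS|exists (t + h) => //=; lra].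
rewrite -/d mulNr -/d; lra.
Unshelve. all: by end_near. Qed.

(** * Error dynamics *)

Section laplacian_families.
Context (R : realType) (N : nat) (a : 'M[R]_N.+1).
Hypotheses (a_weights : digraph_weights a) (a_conn : graph_connected a).
Local Notation L := (lift ord0).

Lemma laplacian_formC (V : lmodType R) (B : V -> V -> R) (e f : 'I_N -> V) :
  symbilin B ->
  \sum_i B (laplacian a e i) (f i) = \sum_i B (laplacian a f i) (e i).
Proof.
move=> hB; rewrite !(laplacian_form a_conn _ _ hB); congr (_ + _ * _).
  by apply: eq_bigr => i _; rewrite (bilC hB).
by apply: eq_bigr => i _; apply: eq_bigr => j _; rewrite (bilC hB).
Qed.

Lemma laplacianP (V : lmodType R) k (e f : 'I_N -> V) i :
  laplacian a (fun i => k *: e i + f i) i = k *: laplacian a e i + laplacian a f i.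
Proof.
rewrite /laplacian !scalerDr addrACA; congr (_ + _).
  by rewrite !scalerA mulrC.
rewrite scaler_sumr -big_split; apply: eq_bigr => j _ /=.
by rewrite opprD addrACA -scalerBr scalerDr !scalerA mulrC.
Qed.

Lemma laplacian_mulmx m n (M : 'M[R]_(m, n)) (e : 'I_N -> 'cV[R]_n) i :
  laplacian a (fun i => M *m e i) i = M *m laplacian a e i.
Proof.
rewrite /laplacian mulmxDr mulmx_sumr -scalemxAr; congr (_ + _).
by apply: eq_bigr => j _; rewrite -scalemxAr mulmxBr.
Qed.

Lemma laplacian_bil (V : lmodType R) (B : V -> V -> R) x (e : 'I_N -> V) i :
  symbilin B ->
  laplacian a (fun i => B x (e i) : R^o) i = B x (laplacian a e i).
Proof.
move=> hB; rewrite /laplacian (bilDr hB) (bilZr hB) (bil_sumr hB); congr (_ + _).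
by apply: eq_bigr => j _; rewrite (bilZr hB) (bilBr hB).
Qed.

Lemma laplacian_dot_le n : exists2 C, 0 < C & forall e : 'I_N -> 'cV[R]_n,
  \sum_i dot (laplacian a e i) (laplacian a e i) <= C * \sum_i dot (e i) (e i).
Proof.
have hM : symbilin (qform ((laplacian_mx a)^T *m laplacian_mx a)).
  by apply: symbilin_qform; rewrite trmx_mul trmxK.
have [C C0 HC] := bil_le_dot hM; exists C => // e.
rewrite /dot exchange_big [X in C * X]exchange_big mulr_sumr; apply: ler_sum => k _ /=.
have := HC (\col_i e i k 0); set y := \col_i _.
have -> : dot y y = \sum_i e i k 0 * e i k 0 by apply: eq_bigr => i _; rewrite mxE.
have -> : qform ((laplacian_mx a)^T *m laplacian_mx a) y y =
    dot (laplacian_mx a *m y) (laplacian_mx a *m y).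
  by rewrite /qform dotE trmx_mul !mulmxA.
move=> /(le_trans (ler_norm _)); apply: le_trans; rewrite le_eqVlt; apply/orP; left; apply/eqP.
apply: eq_bigr => i _; rewrite laplacian_mxE.
suff -> : laplacian a e i k 0 = laplacian a (fun i => y i 0 : R^o) i by [].
rewrite /laplacian !mxE summxE; congr (_ + _).
by apply: eq_bigr => j _; rewrite !mxE.
Qed.

End laplacian_families.

Definition feedback (R : realType) (N n : nat) (a : 'M[R]_N.+1) (P : 'M[R]_n)
    (d : 'cV[R]_n) (e : 'I_N -> 'cV[R]_n) (i : 'I_N) : R :=
  qform P d (laplacian a e i).

Section error_dynamics.
Context (R : realType) (N : nat) (a : 'M[R]_N.+1).
Hypotheses (a_weights : digraph_weights a) (a_conn : graph_connected a).
Context (n : nat) (S P : 'M[R]_n) (d : 'cV[R]_n).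
Hypothesis P_pos : posdef P.
Hypothesis P_lmi : posdef (2%:R *: (P *m d *m d^T *m P) - (S^T *m P + P *m S)).

Let hP : symbilin (qform P) := symbilin_qform P_pos.1.

(** The matrix inequality is contracted with the Laplacian. Its rank-one term becomes the scalar
    Laplacian form of the family [d^T P e_i], whose Laplacian is the feedback, so [laplacian_le_sqr]
    bounds it by squared feedbacks. *)
Lemma laplacian_error_decay : exists2 C, 0 < C & exists2 c, 0 < c &
  forall e : 'I_N -> 'cV[R]_n,
    2 * \sum_i qform P (laplacian a e i) (S *m e i) <=
    2 * C * (\sum_i qform P d (laplacian a e i) ^+ 2) - c * \sum_i dot (e i) (e i).
Proof.
have [C C0 HC] := laplacian_le_sqr a_weights a_conn.
have [c c0 Hc] := laplacian_posdef_coercive a_weights a_conn P_lmi.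
exists C => //; exists c => // e.
have lmiE x y : qform (2%:R *: (P *m d *m d^T *m P) - (S^T *m P + P *m S)) x y =
    2 * (qform P d x * qform P d y) - (qform P (S *m x) y + qform P x (S *m y)).
  have EB A B : qform (2%:R *: A - B) x y = 2 * qform A x y - qform B x y.
    by rewrite /qform mulmxBr mulmxBl -scalemxAr -scalemxAl !mxE.
  have ED A B : qform (A + B) x y = qform A x y + qform B x y.
    by rewrite /qform mulmxDr mulmxDl !mxE.
  rewrite EB ED (bilC hP d x); congr (_ * _ - (_ + _)).
  - rewrite /qform (_ : _ *m y = (x^T *m P *m d) *m (d^T *m P *m y)); last by rewrite !mulmxA.
    by rewrite mxE big_ord1.
  - by rewrite /qform trmx_mul !mulmxA.
  - by rewrite /qform !mulmxA.
(* [S] acts within each agent and the Laplacian across agents, so they commute. *)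
have SE : \sum_i qform P (laplacian a e i) (S *m e i) =
    \sum_i qform P (S *m laplacian a e i) (e i).
  rewrite (laplacian_formC a_conn _ _ hP).
  by apply: eq_bigr => i _; rewrite laplacian_mulmx.
have := Hc e; under [X in _ <= X -> _]eq_bigr do rewrite lmiE.
rewrite sumrB big_split /= -SE -mulr_sumr.
have : \sum_i qform P d (laplacian a e i) * qform P d (e i) <=
    C * \sum_i qform P d (laplacian a e i) ^+ 2.
  have := HC (fun i => qform P d (e i)); congr (_ <= _ * _).
    by apply: eq_bigr => i _; rewrite (laplacian_bil a d e i hP).
  by apply: eq_bigr => i _; rewrite (laplacian_bil a d e i hP).
lra.
Qed.

(* The gain threshold G depends on the graph and on the bound l only; it is the
   unknown constant that the adaptive gains theta_i replace. *)
Lemma error_lyapunov_decay (b : 'I_N -> 'cV[R]_n) (l : R) : 0 < l ->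
  exists2 G, 0 <= G & exists2 c, 0 < c & exists2 K, 0 < K &
  forall (e : 'I_N -> 'cV[R]_n) (th p : 'I_N -> R) (v : R), `|v| <= l ->
    2 * \sum_i qform P (laplacian a e i) (S *m e i -
          (th i * feedback a P d e i +
            th i * Num.sg (feedback a P d e i) + v) *: d + p i *: b i) +
    2 * \sum_i (th i - G) * (feedback a P d e i ^+ 2 + `|feedback a P d e i|) <=
    - c * \sum_i dot (e i) (e i) + K * \sum_i p i ^+ 2.
Proof.
move=> l0; have [C C0 [c c0 Hc]] := laplacian_error_decay.
have [Cl Cl0 HCl] := laplacian_dot_le a n.
pose kb := \sum_i dot (P *m b i) (P *m b i).
have kb0 : 0 <= kb by apply: sumr_ge0 => i _; exact: dot_ge0.
(* Weight in Young's inequality for the terms in [p i]: after [laplacian_dot_le] their share of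
   [|u|^2] costs at most [c / 2] times the squared errors, half of the decay. The price is
   [K = r^-1]. *)
pose r := c / (2 * (kb + 1) * Cl).
have r0 : 0 < r by rewrite divr_gt0 // mulr_gt0 //; lra.
exists (C + l); first by lra.
exists (c / 2); first by rewrite divr_gt0.
exists r^-1; first by rewrite invr_gt0.
move=> e th p v vl; set s := feedback a P d e; set u := laplacian a e.
have Hrho i : qform P (u i) (b i) ^+ 2 <= (kb + 1) * dot (u i) (u i).
  rewrite -dot_mulmx; apply: le_trans (bil_cauchy_schwarz (@symbilin_dot R n) _ _ (@dot_ge0 _ _)) _.
  rewrite mulrC ler_wpM2r ?dot_ge0 // /kb (bigD1 i) //= -addrA lerDl addr_ge0 //.
  by apply: sumr_ge0 => j _; exact: dot_ge0.
have step i : qform P (u i) (S *m e i - (th i * s i + th i * Num.sg (s i) + v) *: d + p i *: b i)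
    + (th i - (C + l)) * (s i ^+ 2 + `|s i|) <=
    qform P (u i) (S *m e i) - C * s i ^+ 2 + 2^-1 * (r * ((kb + 1) * dot (u i) (u i)) + r^-1 * p i ^+ 2).
  rewrite (bilDr hP) (bilBr hP) !(bilZr hP) (bilC hP (u i) d) -/(s i).
  (* This identity makes the terms in [th i] cancel identically. *)
  have hsg : Num.sg (s i) * s i = `|s i| by rewrite mulrC normrEsg mulrC.
  have hv : - (v * s i) <= l * `|s i|.
    rewrite -normrN -mulNr; apply: le_trans (ler_norm _) _; rewrite normrM normrN.
    by rewrite normrN ler_wpM2r.
  have hp : p i * qform P (u i) (b i) <= 2^-1 * (r * ((kb + 1) * dot (u i) (u i)) + r^-1 * p i ^+ 2).
    apply: le_trans (_ : 2^-1 * (r * qform P (u i) (b i) ^+ 2 + r^-1 * p i ^+ 2) <= _).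
      rewrite -subr_ge0.
      have -> : 2^-1 * (r * qform P (u i) (b i) ^+ 2 + r^-1 * p i ^+ 2) - p i * qform P (u i) (b i)
        = (r * qform P (u i) (b i) - p i) ^+ 2 / (2 * r) by field; lra.
      by rewrite divr_ge0 ?sqr_ge0 // mulr_ge0 // ltW.
    by rewrite ler_pM2l // lerD2r ler_pM2l.
  have e1 : (th i * s i + th i * Num.sg (s i) + v) * s i = th i * s i ^+ 2 + th i * `|s i| + v * s i.
    by rewrite -hsg; ring.
  rewrite e1.
  have s0 : 0 <= `|s i| by [].
  have s2 : 0 <= l * s i ^+ 2 by rewrite mulr_ge0 ?sqr_ge0 // ltW.
  have s3 : 0 <= C * `|s i| by rewrite mulr_ge0 // ltW.
  lra.
have := @ler_sum _ _ (index_enum _) xpredT _ _ (fun i _ => step i).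
rewrite !big_split /= -!mulr_sumr -/u => H.
rewrite -mulrDr; apply: le_trans (ler_wpM2l _ H) _ => //.
rewrite sumrN -!mulr_sumr.
have := Hc e; rewrite -/u.
have : 2 * (2^-1 * (r * ((kb + 1) * \sum_i dot (u i) (u i)))) <= c / 2 * \sum_i dot (e i) (e i).
  rewrite mulrA mulfV // mul1r mulrA.
  apply: le_trans (ler_wpM2l _ (HCl e)) _; first by rewrite mulr_ge0 //; lra.
  rewrite mulrA le_eqVlt; apply/orP; left; apply/eqP; congr (_ * _).
  by rewrite /r; field; lra.
rewrite /s big_split -!mulr_sumr /feedback /= -/u; lra.
Qed.

End error_dynamics.

(** * State coordinates and the closed-loop vector field *)

Section state_coordinates.
Context (R : realType) (N n0 : nat) (ag : 'I_N -> agent R).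
Local Notation T := (total_dim n0 ag (law_dim n0 ag)).
Implicit Types X Y : 'cV[R]_T.

Definition leader X := st_w (unpack X).
Definition obs_err X i := st_z (unpack X) i - st_xi (unpack X) i.
Definition sync_err X i := xhat (unpack X) i - st_w (unpack X).
Definition gain X i := st_theta (unpack X) i.
Definition copy X i := st_xi (unpack X) i.
Definition plant X i := st_x (unpack X) i.

Lemma unpack_pack (s : cstate n0 ag (law_dim n0 ag)) : unpack (pack s) = s.
Proof.
case: s => w z x c; rewrite /unpack /pack /= col_mxKu col_mxKd.
congr CState; apply: functional_extensionality_dep => i;
  by rewrite mxcolK ?col_mxKu // col_mxKd ?col_mxKu ?col_mxKd.
Qed.

Lemma entryP n k (x y : 'cV[R]_n) j : entry (k *: x + y) j = k * entry x j + entry y j.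
Proof. by rewrite /entry; case: insub => [i|]; rewrite ?mxE ?mulr0 ?addr0. Qed.

Lemma plantP k X Y i : plant (k *: X + Y) i = k *: plant X i + plant Y i.
Proof. by apply/colP => j; rewrite !mxE. Qed.

Lemma copyP k X Y i : copy (k *: X + Y) i = k *: copy X i + copy Y i.
Proof. by apply/colP => j; rewrite !mxE. Qed.

Lemma gainP k X Y i : gain (k *: X + Y) i = k * gain X i + gain Y i.
Proof. by rewrite /gain /st_theta !mxE. Qed.

Lemma leaderP k X Y : leader (k *: X + Y) = k *: leader X + leader Y.
Proof. by apply/colP => j; rewrite !mxE. Qed.

Lemma st_zP k X Y i :
  st_z (unpack (k *: X + Y)) i = k *: st_z (unpack X) i + st_z (unpack Y) i.
Proof. by apply/colP => j; rewrite !mxE. Qed.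

Lemma st_chiP k X Y i :
  st_chi (unpack (k *: X + Y)) i = k *: st_chi (unpack X) i + st_chi (unpack Y) i.
Proof. by apply/colP => j; rewrite !mxE. Qed.

Lemma obs_errP k X Y i : obs_err (k *: X + Y) i = k *: obs_err X i + obs_err Y i.
Proof. by rewrite /obs_err st_zP -!/(copy _ i) copyP opprD addrACA -scalerBr. Qed.

Lemma sync_errP k X Y i : sync_err (k *: X + Y) i = k *: sync_err X i + sync_err Y i.
Proof.
rewrite /sync_err -!/(leader _) leaderP; apply/colP => j; rewrite !mxE.
rewrite -/(plant _ i) plantP st_chiP !entryP -/(plant X i) -/(plant Y i).
by case: ifP => _; ring.
Qed.

Lemma xhatE X i : xhat (unpack X) i = sync_err X i + leader X.
Proof. by rewrite subrK. Qed.

Lemma plant_xhat X i j (jn : (xdim (ag i) <= n0)%N) :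
  plant X i j 0 = xhat (unpack X) i (widen_ord jn j) 0.
Proof.
rewrite [RHS]mxE /= ltn_ord /entry insubT ?ltn_ord //= => lt.
by congr (st_x _ i _ 0); exact: val_inj.
Qed.

Lemma chi_xhat X i (j : 'I_(n0 - xdim (ag i))) :
  exists k, st_chi (unpack X) i j 0 = xhat (unpack X) i k 0.
Proof.
have lt : (xdim (ag i) + j < n0)%N by rewrite -ltn_subRL.
exists (Ordinal lt); rewrite [RHS]mxE /= ltnNge leq_addr /= addKn /entry.
by rewrite insubT ?ltn_ord //= => lt'; congr (st_chi _ i _ 0); exact: val_inj.
Qed.

(** The leader state, the two errors, the gains and [xi] together are linear coordinates on the
    state, since [xhat] contains all plant and chain states when [xdim <= n0]. Only injectivity is
    recorded. *)
Lemma state_eq0 X : (forall i, xdim (ag i) <= n0)%N -> leader X = 0 ->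
  (forall i, sync_err X i = 0) -> (forall i, obs_err X i = 0) ->
  (forall i, gain X i = 0) -> (forall i, copy X i = 0) -> X = 0.
Proof.
move=> A2 w0 e0 z0 th0 xi0.
have h0 i : xhat (unpack X) i = 0 by rewrite xhatE e0 w0 addr0.
have x0 i : st_x (unpack X) i = 0.
  by apply/colP => j; rewrite -/(plant X i) (plant_xhat _ _ (A2 i)) h0 !mxE.
have chi0 i : st_chi (unpack X) i = 0.
  by apply/colP => j; have [k ->] := chi_xhat X j; rewrite h0 !mxE.
have zz i : st_z (unpack X) i = 0 by have := z0 i; rewrite /obs_err -/(copy X i) xi0 subr0.
have c0 i : st_c (unpack X) i = 0.
  rewrite -[LHS]vsubmxK -/(st_chi _ i) chi0 -[dsubmx _]vsubmxK.
  rewrite -/(st_xi (unpack X) i) -/(copy X i) xi0.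
  rewrite (_ : usubmx _ = 0) ?col_mx0 ?col_mx0 //.
  by apply/matrixP => j k; rewrite !ord1; have := th0 i; rewrite /gain /st_theta => ->; rewrite mxE.
have Xu : usubmx X = 0 := w0.
have Xd : dsubmx X = 0.
  rewrite -[LHS]submxcolK; apply/mxcolP => i; rewrite mxcolK submxcol0.
  pose Xi : 'cV_(zdim (ag i) + (xdim (ag i) + law_dim n0 ag i)) := submxcol (dsubmx X) i.
  have X1 : usubmx Xi = 0 := zz i.
  have X2 : usubmx (dsubmx Xi) = 0 := x0 i.
  have X3 : dsubmx (dsubmx Xi) = 0 := c0 i.
  by rewrite -[LHS]/Xi -[Xi]vsubmxK X1 -[dsubmx Xi]vsubmxK X2 X3 !col_mx0.
by rewrite -[X]vsubmxK Xu Xd col_mx0.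
Qed.

End state_coordinates.

(** * The closed loop in error coordinates *)

Section closed_loop_vector_field.
Context (R : realType) (N n0 : nat) (ag : 'I_N -> agent R)
  (s0 : 'I_n0 -> R) (dn : R) (a : 'M[R]_N.+1) (P : 'M[R]_n0) (v : R -> R).
Hypothesis ag_pos : forall i, (1 <= xdim (ag i))%N.
Hypothesis A2 : forall i, (xdim (ag i) <= n0)%N.
Local Notation T := (total_dim n0 ag (law_dim n0 ag)).
Local Notation F := (closed_loop s0 dn (K := adaptive_law ag s0 dn a P) v).
Local Notation d := (dvec n0 dn).
Implicit Types X : 'cV[R]_T.

Definition mismatch X i : R :=
  agent_g (st_z (unpack X) i) (plant X i) - agent_g (copy X i) (plant X i).

(** The mismatch enters at the last plant state, of zero-based index [xdim - 1], which is in general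
    not the last entry of [xhat]. *)
Definition input_row (i : 'I_N) : 'cV[R]_n0 := \col_(k < n0) (k.+1 == xdim (ag i))%:R.

Lemma xhat_v_laplacian X i : xhat_v a (unpack X) i = laplacian a (sync_err X) i.
Proof.
rewrite /xhat_v big_ord_recl /laplacian; congr (_ *: _ + _).
  by rewrite /xhat_node unlift_none.
apply: eq_bigr => j _; congr (_ *: _); rewrite /xhat_node liftK /sync_err.
by rewrite opprB addrA subrK.
Qed.

Lemma sigma_feedback X i : sigma dn a P (unpack X) i = feedback a P d (sync_err X) i.
Proof. by rewrite /sigma xhat_v_laplacian. Qed.

Lemma leader_closed_loop X t : leader (F X t) = Smx s0 *m leader X + v t *: d.
Proof. by rewrite /leader /closed_loop unpack_pack. Qed.

Lemma gain_closed_loop X t i : gain (F X t) i =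
  feedback a P d (sync_err X) i ^+ 2 + `|feedback a P d (sync_err X) i|.
Proof.
rewrite /gain /closed_loop unpack_pack /st_theta /= /law_dyn col_mxKd col_mxKu mxE.
by rewrite sigma_feedback.
Qed.

Lemma copy_closed_loop X t i :
  copy (F X t) i = agent_A (ag i) *m copy X i + agent_f (plant X i).
Proof. by rewrite /copy /closed_loop unpack_pack /st_xi /= /law_dyn !col_mxKd. Qed.

Lemma obs_err_closed_loop X t i : obs_err (F X t) i = agent_A (ag i) *m obs_err X i.
Proof.
rewrite /obs_err -/(copy (F X t) i) copy_closed_loop /closed_loop unpack_pack /=.
by rewrite /zdyn /plant opprD addrACA subrr addr0 mulmxBr.
Qed.

Lemma entry_lt n (x : 'cV[R]_n) k (kn : (k < n)%N) : entry x k = x (Ordinal kn) 0.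
Proof. by rewrite /entry insubT. Qed.

Lemma last_rhsE X i : last_rhs s0 dn a P (unpack X) i =
  \sum_(j < n0) s0 j * xhat (unpack X) i j 0 -
  dn * (gain X i * feedback a P d (sync_err X) i +
        gain X i * Num.sg (feedback a P d (sync_err X) i)).
Proof. by rewrite /last_rhs sigma_feedback /gain; ring. Qed.

Lemma Smx_row (x : 'cV[R]_n0) (k : 'I_n0) : (Smx s0 *m x) k 0 =
  if (k.+1 < n0)%N then entry x k.+1 else \sum_j s0 j * x j 0.
Proof.
rewrite mxE; case: ifP => kn; last by apply: eq_bigr => j _; rewrite mxE kn.
rewrite (bigD1 (Ordinal kn)) //= mxE kn eqxx mul1r entry_lt big1 ?addr0 // => j jk.
by rewrite mxE kn (_ : (j == k.+1 :> nat) = false) ?mul0r //; apply/negbTE.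
Qed.

(** Plant and controller chain join into one chain of length [n0] closed by the last row of the
    leader's companion matrix. *)
Lemma xhat_closed_loop X t i : xhat (unpack (F X t)) i = Smx s0 *m xhat (unpack X) i
  - (gain X i * feedback a P d (sync_err X) i +
     gain X i * Num.sg (feedback a P d (sync_err X) i)) *: d
  + mismatch X i *: input_row i.
Proof.
apply/colP => k; set w := _ + _ * Num.sg _.
have -> : (Smx s0 *m xhat (unpack X) i - w *: d + mismatch X i *: input_row i) k 0 =
    (Smx s0 *m xhat (unpack X) i) k 0 - w * (if (k.+1 < n0)%N then 0 else dn)
    + mismatch X i * (k.+1 == xdim (ag i))%:R.
  rewrite [LHS]mxE; congr (_ + _); last by rewrite !mxE.
  by rewrite [LHS]mxE; congr (_ + _); rewrite !mxE.
rewrite Smx_row [LHS]mxE /closed_loop unpack_pack /=.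
have xhE (j : nat) (jn : (j < n0)%N) : entry (xhat (unpack X) i) j =
    if (j < xdim (ag i))%N then entry (plant X i) j
    else entry (st_chi (unpack X) i) (j - xdim (ag i)).
  by rewrite entry_lt mxE.
have kn0 := ltn_ord k; have An := A2 i.
case: ifP => kx.
  rewrite entry_lt mxE /=; have [k1x|] := ltnP k.+1 (xdim (ag i)).
    rewrite (leq_trans k1x An) xhE ?(leq_trans k1x An) // k1x.
    by rewrite (ltn_eqF k1x) !mulr0 subr0 addr0.
  (* The junction row: the input replaces [g_i] by the mismatch and passes on the first chain state,
     or the last row itself when [xdim = n0]. *)
  move=> xk; have xE : xdim (ag i) = k.+1 by apply/eqP; rewrite eqn_leq xk kx.
  rewrite -xE eqxx mulr1 /law_input.
  case: ifP => xn; last by rewrite last_rhsE -/w /mismatch /copy /plant; ring.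
  by rewrite xhE // ltnn subnn /mismatch /copy /plant; ring.
have xk : (xdim (ag i) <= k)%N by rewrite leqNgt kx.
have kc : (k - xdim (ag i) < n0 - xdim (ag i))%N by rewrite ltn_sub2r // (leq_ltn_trans xk).
rewrite /st_chi /= /law_dyn col_mxKu entry_lt mxE /= -subSn // ltn_sub2rE; last first.
  exact: leqW.
rewrite (gtn_eqF (_ : xdim (ag i) < k.+1)%N) // mulr0 addr0.
case: ifP => k1n; last by rewrite last_rhsE -/w; ring.
by rewrite xhE // ltnNge leqW //= mulr0 subr0.
Qed.

Lemma sync_err_closed_loop X t i : sync_err (F X t) i = Smx s0 *m sync_err X i
  - (gain X i * feedback a P d (sync_err X) i +
     gain X i * Num.sg (feedback a P d (sync_err X) i) + v t) *: d
  + mismatch X i *: input_row i.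
Proof.
rewrite {1}/sync_err xhat_closed_loop -/(leader (F X t)) leader_closed_loop.
rewrite /sync_err -/(leader X) mulmxBr.
set w := _ + _ * Num.sg _; rewrite [(w + v t) *: d]scalerDl !opprD.
apply/colP => k; move: (Smx s0 *m xhat _ _) (Smx s0 *m leader X) (w *: d) (v t *: d).
by move=> x y z u; rewrite !mxE; ring.
Qed.

Lemma tracking_errorE X i : tracking_error X i = sync_err X i (Ordinal (leq_trans (ag_pos i) (A2 i))) 0.
Proof.
rewrite /tracking_error /sync_err [RHS]mxE [X in _ = _ + X]mxE; congr (_ - _).
  by rewrite [RHS]mxE /= ag_pos.
move: (st_w _) (Ordinal _) (erefl : val (Ordinal (leq_trans (ag_pos i) (A2 i))) = 0%N) => w o o0.
rewrite mxE (bigD1 o) //= !mxE o0 eqxx mul1r big1 ?addr0 // => j jo.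
rewrite !mxE (_ : (j == 0 :> nat) = false) ?mul0r //.
by apply: contra_neqF jo => /eqP j0; apply: val_inj; rewrite /= j0 o0.
Qed.

End closed_loop_vector_field.

(** * Bounds on forms and on continuous maps *)

Section forms.
Context (R : realType).

Lemma symbilin_pullback (U V : lmodType R) (B : V -> V -> R) (f : U -> V) :
  (forall k x y, f (k *: x + y) = k *: f x + f y) -> symbilin B ->
  symbilin (fun x y => B (f x) (f y)).
Proof. by move=> hf [B1 B2]; split=> [x y|k x y z]; rewrite ?hf. Qed.

Lemma symbilin_sum (U : lmodType R) (I : finType) (B : I -> U -> U -> R) :
  (forall i, symbilin (B i)) -> symbilin (fun x y => \sum_i B i x y).
Proof.
move=> hB; split=> [x y|k x y z]; first by apply: eq_bigr => i _; exact: (hB i).1.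
by rewrite mulr_sumr -big_split; apply: eq_bigr => i _; exact: (hB i).2.
Qed.

Lemma symbilin_add (U : lmodType R) (B C : U -> U -> R) :
  symbilin B -> symbilin C -> symbilin (fun x y => B x y + C x y).
Proof.
by move=> [B1 B2] [C1 C2]; split=> [x y|k x y z]; rewrite ?B2 ?C2; [rewrite B1 C1|ring].
Qed.

Lemma symbilin_scale (U : lmodType R) (B : U -> U -> R) (k : R) :
  symbilin B -> symbilin (fun x y => k * B x y).
Proof. by move=> [B1 B2]; split=> [x y|q x y z]; rewrite ?B2; [rewrite B1|ring]. Qed.

Lemma bil_young (U : lmodType R) (B : U -> U -> R) x y : symbilin B ->
  (forall z, 0 <= B z z) -> `|2 * B x y| <= B x x + B y y.
Proof.
move=> hB B0; have := B0 (x + y); have := B0 (x - y).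
rewrite !(bilDl hB, bilDr hB, bilNl hB, bilNr hB) (bilC hB y x) ler_norml.
by move=> ? ?; apply/andP; split; lra.
Qed.

Lemma bil_sqr2 (U : lmodType R) (B : U -> U -> R) x y : symbilin B ->
  (forall u, 0 <= B u u) -> B (x + y) (x + y) <= 2 * (B x x + B y y).
Proof.
move=> hB B0; have := B0 (x - y).
rewrite !(bilDl hB, bilDr hB, bilNl hB, bilNr hB) (bilC hB y x); lra.
Qed.

Lemma bil_sqr3 (U : lmodType R) (B : U -> U -> R) x y z : symbilin B ->
  (forall u, 0 <= B u u) ->
  B (x - y + z) (x - y + z) <= 3 * (B x x + B y y + B z z).
Proof.
move=> hB B0; have := B0 (x + y); have := B0 (x - z); have := B0 (y + z).
rewrite !(bilDl hB, bilDr hB, bilNl hB, bilNr hB) (bilC hB y x) (bilC hB z x) (bilC hB z y).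
lra.
Qed.

Lemma lin_sub (U V : lmodType R) (f : U -> V) :
  (forall k x y, f (k *: x + y) = k *: f x + f y) -> forall x y, f (x - y) = f x - f y.
Proof. by move=> hf x y; rewrite addrC -scaleN1r hf scaleN1r addrC. Qed.

Lemma affine_growth n (A : 'M[R]_n) (H : R) : 0 <= H ->
  exists2 k, 0 <= k & forall w h, dot h h <= H ->
    2 * dot w (A *m w + h) <= k * (1 + dot w w).
Proof.
move=> H0; have hB : symbilin (qform (A + A^T)).
  by apply: symbilin_qform; rewrite linearD /= trmxK addrC.
have hd := @symbilin_dot R n.
have [C C0 HC] := bil_le_dot hB; exists (C + 1 + H); first by lra.
move=> w h hH; have := le_trans (ler_norm _) (HC w).
have -> : qform (A + A^T) w w = 2 * dot w (A *m w).
  have e2 : qform A^T w w = dot w (A *m w).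
    rewrite (bilC hd) dotE trmx_mul /qform //.
  have -> : qform (A + A^T) w w = qform A w w + qform A^T w w.
    by rewrite /qform mulmxDr mulmxDl mxE.
  by rewrite e2 -dot_mulmx; ring.
have := dot_ge0 (w - h); rewrite !(bilDr hd, bilDl hd, bilNl hd, bilNr hd) (bilC hd h w).
have w0 := dot_ge0 w; have : 0 <= H * dot w w by rewrite mulr_ge0.
lra.
Qed.

Lemma continuous_bounded_on_ball p q (f : 'cV[R]_p -> 'cV[R]_q) (K : R) :
  continuous f -> exists2 H, 0 <= H & forall x, dot x x <= K -> dot (f x) (f x) <= H.
Proof.
(* The compact box is made of row vectors to fit [rV_compact], hence the transposes. Its half-side
   works because [x_i^2 <= K] forces [|x_i| <= |K| + 1]. *)
move=> cf; pose A := [set y : 'rV[R]_p | forall i, -(`|K| + 1) <= y 0 i <= `|K| + 1].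
have cA : compact A.
  have := @rV_compact R p (fun=> `[- (`|K| + 1), (`|K| + 1)]%classic) (fun=> @segment_compact _ _ _).
  congr (compact _); apply/seteqP; split => y Ay i; have := Ay i; rewrite /= in_itv //.
pose h (y : 'rV[R]_p) := dot (f y^T) (f y^T).
have ch : continuous h.
  move=> y; have ct : continuous (fun y : 'rV[R]_p => y^T : 'cV[R]_p).
    move=> u; apply: (@cvg_mx _ _ (nbhs u) (nbhs_filter u)) => i j.
    have := @coord_continuous R 1 p j i u; rewrite /continuous_at => cu.
    by rewrite mxE; under eq_cvg do rewrite mxE; exact: cu.
  have cfy : f y^T @[y --> y] --> f y^T.
    exact: (@cvg_comp _ _ _ (fun y : 'rV[R]_p => y^T : 'cV[R]_p) f _ _ _ (ct y) (cf y^T)).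
  exact: (@cvg_bil _ _ (nbhs y) (nbhs_filter y) _ _ _ _ _ _ (@symbilin_dot R q) cfy cfy).
have /compact_bounded[M [_ HM]] : compact (h @` A).
  by apply: continuous_compact => //; exact: continuous_subspaceT.
exists (`|M| + 1); first by rewrite addr_ge0.
move=> x xK; apply: le_trans (ler_norm _) _.
apply: (HM (`|M| + 1)); first by have := ler_norm M; lra.
exists x^T; last by rewrite /h trmxK.
move=> i; rewrite mxE -ler_norml.
have xi : x i 0 ^+ 2 <= K.
  apply: le_trans xK; rewrite /dot (bigD1 i) //= -expr2 lerDl.
  by apply: sumr_ge0 => j _; rewrite -expr2 sqr_ge0.
have := ler_norm K; have : 0 <= (`|x i 0| - 1) ^+ 2 by exact: sqr_ge0.
have : `|x i 0| ^+ 2 = x i 0 ^+ 2 by rewrite real_normK ?num_real.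
nra.
Qed.

End forms.

(** * Continuity of the Lyapunov derivative *)

Section closed_loop_forms.
Context (R : realType) (N n0 : nat) (ag : 'I_N -> agent R)
  (s0 : 'I_n0 -> R) (dn : R) (a : 'M[R]_N.+1) (P : 'M[R]_n0) (v : R -> R).
Hypothesis ag_wf : forall i, agent_wf (ag i).
Hypotheses (a_weights : digraph_weights a) (a_conn : graph_connected a).
Hypothesis A2 : forall i, (xdim (ag i) <= n0)%N.
Hypothesis P_pos : posdef P.
Local Notation T := (total_dim n0 ag (law_dim n0 ag)).
Local Notation F := (closed_loop s0 dn (K := adaptive_law ag s0 dn a P) v).
Local Notation d := (dvec n0 dn).
Local Notation fb := (feedback a P d).
Implicit Types X Y : 'cV[R]_T.

Let hP : symbilin (qform P) := symbilin_qform P_pos.1.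
Let ag_pos i : (1 <= xdim (ag i))%N. Proof. by case: (ag_wf i). Qed.

Definition sync_form X Y := \sum_i qform P (laplacian a (sync_err X) i) (sync_err Y i).
Definition gain_form X Y := \sum_i gain X i * gain Y i.
Definition obs_form (Q : forall i, 'cV[R]_(zdim (ag i)) -> 'cV[R]_(zdim (ag i)) -> R) X Y :=
  \sum_i Q i (obs_err X i) (obs_err Y i).

Lemma laplacian_sync_errP k X Y i : laplacian a (sync_err (k *: X + Y)) i =
  k *: laplacian a (sync_err X) i + laplacian a (sync_err Y) i.
Proof.
rewrite -laplacianP /laplacian sync_errP; congr (_ + _).
by apply: eq_bigr => j _; rewrite !sync_errP.
Qed.

Lemma feedbackP k X Y i : fb (sync_err (k *: X + Y)) i =
  k * fb (sync_err X) i + fb (sync_err Y) i.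
Proof. by rewrite /feedback laplacian_sync_errP (bilDr hP) (bilZr hP). Qed.

Lemma symbilin_sync_form : symbilin sync_form.
Proof.
split=> [X Y|k X Y Z]; first exact: laplacian_formC.
rewrite /sync_form mulr_sumr -big_split; apply: eq_bigr => i _ /=.
by rewrite laplacian_sync_errP hP.2.
Qed.

Lemma symbilin_gain_form : symbilin gain_form.
Proof.
apply: symbilin_sum => i; split=> [X Y|k X Y Z]; first by rewrite mulrC.
by rewrite gainP; ring.
Qed.

Lemma symbilin_obs_form Q : (forall i, symbilin (Q i)) -> symbilin (obs_form Q).
Proof.
move=> hQ; apply: symbilin_sum => i; apply: symbilin_pullback => // k X Y.
exact: obs_errP.
Qed.

Section continuity.
Context {S : Type} (G : set_system S) {FG : Filter G} (f : S -> 'cV[R]_T) (z : 'cV[R]_T).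
Hypothesis fz : f x @[x --> G] --> z.

(* Used instead of rewriting: comparing two instances of the vector field up
   to conversion is prohibitively slow. *)
Lemma cvg_congr (g h : S -> R) (k k' : R) :
  (forall x, g x = h x) -> k = k' -> h x @[x --> G] --> k' -> g x @[x --> G] --> k.
Proof. by move=> gh ->; rewrite (functional_extensionality_dep gh). Qed.

Lemma cvg_linear_map n (g : 'cV[R]_T -> 'cV[R]_n) :
  (forall k x y, g (k *: x + y) = k *: g x + g y) -> g (f x) @[x --> G] --> g z.
Proof.
move=> hg; apply: cvg_mx => i j; apply: (cvg_scalin (l := fun x => g x i j)) fz.
by move=> k x y; rewrite hg !mxE.
Qed.

Lemma cvg_gain i : gain (f x) i @[x --> G] --> gain z i.
Proof. by apply: (cvg_scalin (l := fun x => gain x i)) fz => k x y; rewrite gainP. Qed.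

Lemma cvg_feedback i : fb (sync_err (f x)) i @[x --> G] --> fb (sync_err z) i.
Proof. by apply: (cvg_scalin (l := fun x => fb (sync_err x) i)) fz => k x y; rewrite feedbackP. Qed.

Lemma cvg_mismatch i : mismatch (f x) i @[x --> G] --> mismatch z i.
Proof.
have [_ _ _ /(_ 0%N) /= cg] := ag_wf i.
have h (u : 'cV[R]_T -> 'cV[R]_(zdim (ag i))) :
    (forall k x y, u (k *: x + y) = k *: u x + u y) ->
    agent_g (u (f x)) (plant (f x) i) @[x --> G] --> agent_g (u z) (plant z i).
  move=> hu; have up : (u (f x), plant (f x) i) @[x --> G] --> (u z, plant z i).
    exact: cvg_pair (cvg_linear_map hu) (cvg_linear_map (fun k x y => plantP k x y i)).
  exact: (@cvg_comp _ _ _ _ (fun p => agent_g p.1 p.2) _ _ _ up (cg _)).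
apply: (cvgB (h (fun x => st_z (unpack x) i) _) (h (fun x => copy x i) _)).
  by move=> k x y; exact: st_zP.
by move=> k x y; exact: copyP.
Qed.

(** The outer factor is the limit and not the moving signal, because the form is tested against a
    fixed vector. If it is 0 the product is identically 0; otherwise the sign is eventually
    constant. *)
Lemma cvg_mul_sgn (s th : S -> R) (ls lth : R) :
  s x @[x --> G] --> ls -> th x @[x --> G] --> lth ->
  ls * (th x * Num.sg (s x)) @[x --> G] --> ls * (lth * Num.sg ls).
Proof.
move=> hs hth; have [->|ls0] := eqVneq ls 0.
  by under eq_cvg do rewrite mul0r; rewrite mul0r; exact: cvg_cst.
apply: cvgMl_tmp; apply: cvgM => //.
apply: cvg_near_cst; have l0 : 0 < `|ls| by rewrite normr_gt0.
move/cvgrPdist_lt : hs => /(_ _ l0); apply: filterS => x.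
case: (ltrgtP ls 0) ls0 => // ls0 _.
  rewrite (ltr0_norm ls0) ltr_norml => /andP[? ?].
  by rewrite !ltr0_sg //; lra.
rewrite (gtr0_norm ls0) ltr_norml => /andP[? ?].
by rewrite !gtr0_sg //; lra.
Qed.

(* The discontinuous term is multiplied by the feedback of U, which vanishes
   where sgn jumps. *)
Lemma cvg_sync_form (U : 'cV[R]_T) t : sync_err U = sync_err z ->
  sync_form U (F (f x) t) @[x --> G] --> sync_form U (F z t).
Proof.
move=> Uz.
have alg (A g s sg w u m q : R) : A - (g * s + g * sg + w) * u + m * q =
    A - (u * (g * s) + u * (g * sg) + u * w) + m * q by ring.
have E X : sync_form U (F X t) = \sum_i
    (qform P (laplacian a (sync_err U) i) (Smx s0 *m sync_err X i)
     - (fb (sync_err U) i * (gain X i * fb (sync_err X) i) +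
        fb (sync_err U) i * (gain X i * Num.sg (fb (sync_err X) i)) +
        fb (sync_err U) i * v t)
     + mismatch X i * qform P (laplacian a (sync_err U) i) (input_row n0 ag i)).
  apply: eq_bigr => i _; rewrite (sync_err_closed_loop _ _ _ _ _ A2) -alg.
  rewrite (bilDr hP) (bilBr hP) (bilZr hP) (bilZr hP).
  by rewrite (bilC hP (laplacian a (sync_err U) i) d).
apply: (cvg_congr (fun x => E (f x)) (E z)).
apply: cvg_sumr => i _; apply: cvgD; last by apply: cvgMr_tmp; exact: cvg_mismatch.
apply: cvgB.
  apply: (cvg_scalin (l := fun x => qform P _ (Smx s0 *m sync_err x i))) fz => k x y.
  by rewrite sync_errP mulmxDr -scalemxAr (bilDr hP) (bilZr hP).
apply: cvgD; last exact: cvg_cst.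
apply: cvgD; last by rewrite Uz; apply: cvg_mul_sgn; [exact: cvg_feedback|exact: cvg_gain].
apply: cvgMl_tmp; apply: cvgM; [exact: cvg_gain|exact: cvg_feedback].
Qed.

Lemma cvg_gain_form U t : gain_form U (F (f x) t) @[x --> G] --> gain_form U (F z t).
Proof.
rewrite /gain_form; apply: cvg_sumr => i _; apply: cvgMl_tmp.
have E X := gain_closed_loop s0 dn a P v X t i.
apply: (cvg_congr (fun x => E (f x)) (E z)).
apply: cvgD; last by apply: cvg_norm; exact: cvg_feedback.
by rewrite expr2; under eq_cvg do rewrite expr2; apply: cvgM; exact: cvg_feedback.
Qed.

Lemma cvg_obs_form Q U t : (forall i, symbilin (Q i)) ->
  obs_form Q U (F (f x) t) @[x --> G] --> obs_form Q U (F z t).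
Proof.
move=> hQ; rewrite /obs_form; apply: cvg_sumr => i _.
have E X := congr1 (Q i (obs_err U i)) (obs_err_closed_loop s0 dn a P v X t i).
apply: (cvg_congr (fun x => E (f x)) (E z)).
apply: (cvg_scalin (l := fun x => Q i _ (agent_A (ag i) *m obs_err x i))) fz => k x y.
by rewrite obs_errP mulmxDr -scalemxAr (bilDr (hQ i)) (bilZr (hQ i)).
Qed.

Lemma cvg_leader_form u t :
  dot u (leader (F (f x) t)) @[x --> G] --> dot u (leader (F z t)).
Proof.
have hd := @symbilin_dot R n0.
have E X := etrans (congr1 (dot u) (leader_closed_loop s0 dn a P v X t)) (bilDr hd _ _ _).
apply: (cvg_congr (fun x => E (f x)) (E z)).
apply: cvgD; last exact: cvg_cst.
apply: (cvg_scalin (l := fun x => dot u (Smx s0 *m leader x))) fz => k x y.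
by rewrite leaderP mulmxDr -scalemxAr (bilDr hd) (bilZr hd).
Qed.

Lemma cvg_copy_form i u t :
  dot u (copy (F (f x) t) i) @[x --> G] --> dot u (copy (F z t) i).
Proof.
have hd := @symbilin_dot R (zdim (ag i)); have [_ _ /(_ 0%N) /= cf _] := ag_wf i.
have E X := etrans (congr1 (dot u) (copy_closed_loop s0 dn a P v X t i)) (bilDr hd _ _ _).
apply: (cvg_congr (fun x => E (f x)) (E z)).
apply: cvgD.
  apply: (cvg_scalin (l := fun x => dot u (agent_A (ag i) *m copy x i))) fz => k x y.
  by rewrite copyP mulmxDr -scalemxAr (bilDr hd) (bilZr hd).
apply: cvg_scalin (symbilin_scalin _ hd) _.
have pz : plant (f x) i @[x --> G] --> plant z i.
  by apply: (cvg_linear_map (g := fun x => plant x i)) => k x y; exact: plantP.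
exact: (@cvg_comp _ _ _ _ (@agent_f _ (ag i)) _ _ _ pz (cf _)).
Qed.

End continuity.

End closed_loop_forms.

(** * The Lyapunov function *)

Section lyapunov_function.
Context (R : realType) (N n0 : nat) (ag : 'I_N -> agent R)
  (s0 : 'I_n0 -> R) (dn : R) (a : 'M[R]_N.+1) (P : 'M[R]_n0) (v : R -> R) (l : R).
Hypothesis ag_wf : forall i, agent_wf (ag i).
Hypotheses (a_weights : digraph_weights a) (a_conn : graph_connected a).
Hypothesis A2 : forall i, (xdim (ag i) <= n0)%N.
Hypothesis A3 : forall i, exists2 M : R, 0 < M &
  forall (z Delta : 'cV[R]_(zdim (ag i))) (x : 'cV[R]_(xdim (ag i))),
    `|agent_g (z + Delta) x - agent_g z x| <= M * enorm Delta.
Hypothesis P_pos : posdef P.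
Hypothesis P_lmi : posdef (2%:R *: (P *m dvec n0 dn *m (dvec n0 dn)^T *m P)
                     - ((Smx s0)^T *m P + P *m Smx s0)).
Hypotheses (l_gt0 : 0 < l) (v_bounded : forall t, `|v t| <= l).
Local Notation T := (total_dim n0 ag (law_dim n0 ag)).
Local Notation F := (closed_loop s0 dn (K := adaptive_law ag s0 dn a P) v).
Local Notation d := (dvec n0 dn).
Local Notation fb := (feedback a P d).
Implicit Types X Y : 'cV[R]_T.

Let hP : symbilin (qform P) := symbilin_qform P_pos.1.
Let ag_pos i : (1 <= xdim (ag i))%N. Proof. by case: (ag_wf i). Qed.

(** The center of the Lyapunov function: subtracting it shifts every gain by [G] and leaves both
    kinds of error unchanged. *)
Definition reference (G : R) : 'cV[R]_T := pack
  (@CState R N n0 ag (law_dim n0 ag) 0 (fun=> 0) (fun=> 0)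
     (fun i => col_mx 0 (col_mx (const_mx G) 0))).

Lemma sync_err_reference G X : sync_err (X - reference G) = sync_err X.
Proof.
apply: functional_extensionality_dep => i.
rewrite (lin_sub (fun k x y => sync_errP k x y i)) [X in _ - X](_ : _ = 0) ?subr0 //.
apply/colP => k; rewrite /sync_err /reference unpack_pack subr0 !mxE /st_chi /= col_mxKu /entry.
by case: ifP => _; case: insub => *; rewrite ?mxE.
Qed.

Lemma obs_err_reference G X : obs_err (X - reference G) = obs_err X.
Proof.
apply: functional_extensionality_dep => i.
rewrite (lin_sub (fun k x y => obs_errP k x y i)) [X in _ - X](_ : _ = 0) ?subr0 //.
by rewrite /obs_err /reference unpack_pack /st_xi /= !col_mxKd subr0.
Qed.

Lemma gain_reference G X i : gain (X - reference G) i = gain X i - G.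
Proof.
rewrite addrC -scaleN1r gainP mulN1r addrC; congr (_ - _).
by rewrite /gain /reference unpack_pack /st_theta /= col_mxKd col_mxKu mxE.
Qed.

Definition lyap (Q : forall i, 'cV[R]_(zdim (ag i)) -> 'cV[R]_(zdim (ag i)) -> R)
    (kap : R) X Y :=
  sync_form a P X Y + gain_form X Y + kap * obs_form Q X Y.

Lemma symbilin_lyap Q kap : (forall i, symbilin (Q i)) -> symbilin (lyap Q kap).
Proof.
move=> hQ; apply: symbilin_add; last exact/symbilin_scale/symbilin_obs_form.
apply: symbilin_add; [exact: symbilin_sync_form|exact: symbilin_gain_form].
Qed.

Lemma mismatch_le : exists2 M, 0 < M & forall X i,
  mismatch X i ^+ 2 <= M * dot (obs_err X i) (obs_err X i).
Proof.
have /choice[M HM] : forall i, exists M, 0 < M /\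
  forall (z Delta : 'cV[R]_(zdim (ag i))) (x : 'cV[R]_(xdim (ag i))),
    `|agent_g (z + Delta) x - agent_g z x| <= M * enorm Delta.
  by move=> i; have [M M0 HM] := A3 i; exists M.
have S0 : 0 <= \sum_i M i ^+ 2 by apply: sumr_ge0 => i _; exact: sqr_ge0.
exists (\sum_i M i ^+ 2 + 1); first by lra.
move=> X i; have [M0 Hi] := HM i.
have := Hi (copy X i) (obs_err X i) (plant X i).
have -> : copy X i + obs_err X i = st_z (unpack X) i by rewrite /obs_err /copy addrC subrK.
rewrite -/(mismatch X i) => H.
rewrite -[mismatch X i ^+ 2]real_normK ?num_real //.
apply: (@le_trans _ _ ((M i * enorm (obs_err X i)) ^+ 2)).
  by rewrite ler_pXn2r ?nnegrE ?mulr_ge0 ?enorm_ge0 // ltW.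
rewrite exprMn enorm_sqr ler_wpM2r ?dot_ge0 // (bigD1 i) //= -addrA lerDl.
by rewrite addr_ge0 // sumr_ge0 // => j _; exact: sqr_ge0.
Qed.

Lemma sync_form_coercive : exists2 c, 0 < c & forall X,
  c * \sum_i dot (sync_err X i) (sync_err X i) <= sync_form a P X X.
Proof.
have [c c0 Hc] := laplacian_posdef_coercive a_weights a_conn P_pos.
by exists c => // X; exact: Hc.
Qed.

Lemma sync_form_le : exists2 C, 0 < C & forall X,
  sync_form a P X X <= C * \sum_i dot (sync_err X i) (sync_err X i).
Proof.
have [C C0 HC] := bil_le_dot hP; have [D D0 HD] := laplacian_dot_le a n0.
have [P0 _] := posdef_coercive P_pos.
have PP x : 0 <= qform P x x.
  by have [->|/(P_pos.2)/ltW//] := eqVneq x 0; rewrite (bil0l hP).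
exists (C * D + C); first by rewrite addr_gt0 // mulr_gt0.
move=> X; have step i : qform P (laplacian a (sync_err X) i) (sync_err X i) <=
    C * dot (laplacian a (sync_err X) i) (laplacian a (sync_err X) i)
    + C * dot (sync_err X i) (sync_err X i).
  have := le_trans (ler_norm _) (bil_young (laplacian a (sync_err X) i) (sync_err X i) hP PP).
  have := le_trans (ler_norm _) (HC (laplacian a (sync_err X) i)).
  have := le_trans (ler_norm _) (HC (sync_err X i)).
  have := PP (laplacian a (sync_err X) i); have := PP (sync_err X i); lra.
have := @ler_sum _ _ (index_enum _) xpredT _ _ (fun i _ => step i).
rewrite big_split /= -!mulr_sumr /sync_form => /le_trans; apply.
by rewrite mulrDl lerD2r -mulrA ler_pM2l.
Qed.

Lemma lyapunov_exists :
  exists (Q : forall i, 'cV[R]_(zdim (ag i)) -> 'cV[R]_(zdim (ag i)) -> R)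
    (kap G c : R), [/\ forall i, symbilin (Q i),
    forall i, exists2 q, 0 < q & forall x, q * dot x x <= Q i x x,
    0 < kap, 0 < c &
    forall X t, 2 * lyap Q kap (X - reference G) (F X t) <= - c * sync_form a P X X].
Proof.
have hur i : hurwitz (agent_A (ag i)) by case: (ag_wf i).
pose Q i := projT1 (cid (hurwitz_lyapunov (hur i))).
have QP i := projT2 (cid (hurwitz_lyapunov (hur i))).
have [M M0 HM] := mismatch_le.
have [G G0 [c c0 [K K0 HK]]] := error_lyapunov_decay a_weights a_conn P_pos P_lmi
  (input_row n0 ag) l_gt0.
have [C C0 HC] := sync_form_le.
(* [kap = K * M] lets the decay of the forms [Q i] pay for [K] times the squared mismatches; [c / C]
   restates the decay of the errors in terms of [sync_form]. *)
exists Q, (K * M), G, (c / C); split=> [i|i|||X t]; rewrite ?divr_gt0 ?mulr_gt0 //.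
- by case: (QP i).
- by case: (QP i).
have := HK (sync_err X) (gain X) (mismatch X) (v t) (v_bounded t).
have -> : \sum_i qform P (laplacian a (sync_err X) i) (Smx s0 *m sync_err X i -
    (gain X i * fb (sync_err X) i + gain X i * Num.sg (fb (sync_err X) i) + v t) *: d
    + mismatch X i *: input_row n0 ag i) = sync_form a P (X - reference G) (F X t).
  rewrite /sync_form sync_err_reference; apply: eq_bigr => i _.
  by rewrite sync_err_closed_loop.
have -> : \sum_i (gain X i - G) * (fb (sync_err X) i ^+ 2 + `|fb (sync_err X) i|) =
    gain_form (X - reference G) (F X t).
  by apply: eq_bigr => i _; rewrite gain_reference gain_closed_loop.
have HO : 2 * obs_form Q (X - reference G) (F X t) <=
    - \sum_i dot (obs_err X i) (obs_err X i).
  rewrite /obs_form mulr_sumr -sumrN obs_err_reference; apply: ler_sum => i _.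
  by rewrite obs_err_closed_loop; have [_ _] := QP i; apply.
have Hp : \sum_i mismatch X i ^+ 2 <= M * \sum_i dot (obs_err X i) (obs_err X i).
  by rewrite mulr_sumr; apply: ler_sum => i _; exact: HM.
have {}Hp : K * \sum_i mismatch X i ^+ 2 <= K * (M * \sum_i dot (obs_err X i) (obs_err X i)).
  by rewrite ler_pM2l.
have {}HO : K * M * (2 * obs_form Q (X - reference G) (F X t)) <=
    K * M * - \sum_i dot (obs_err X i) (obs_err X i).
  by rewrite ler_pM2l // mulr_gt0.
have HE : c / C * sync_form a P X X <= c * \sum_i dot (sync_err X i) (sync_err X i).
  by rewrite -mulrA ler_pM2l // ler_pdivrMl.
rewrite /lyap; lra.
Qed.

Section given_lyapunov.
Context (Q : forall i, 'cV[R]_(zdim (ag i)) -> 'cV[R]_(zdim (ag i)) -> R) (kap G : R).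
Arguments Q : clear implicits.
Hypothesis hQ : forall i, symbilin (Q i).
Hypothesis Qpos : forall i, exists2 q, 0 < q & forall x, q * dot x x <= Q i x x.
Hypothesis kap0 : 0 < kap.
Local Notation V X := (lyap Q kap (X - reference G) (X - reference G)).

Lemma lyap_parts_ge0 X : [/\ 0 <= sync_form a P X X, forall i, 0 <= Q i (obs_err X i) (obs_err X i)
  & V X = sync_form a P X X + \sum_i (gain X i - G) ^+ 2
          + kap * \sum_i Q i (obs_err X i) (obs_err X i)].
Proof.
split.
- have [c c0 Hc] := sync_form_coercive; apply: le_trans (Hc X).
  by apply: mulr_ge0; [exact: ltW|apply: sumr_ge0 => i _; exact: dot_ge0].
- move=> i; have [q q0 Hq] := Qpos i; apply: le_trans (Hq _).
  by rewrite mulr_ge0 ?dot_ge0 // ltW.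
rewrite /lyap /sync_form /obs_form /gain_form sync_err_reference obs_err_reference.
by congr (_ + _ + _); apply: eq_bigr => i _; rewrite gain_reference expr2.
Qed.

Lemma lyap_ge0 X : 0 <= V X.
Proof.
have [S0 Q0 ->] := lyap_parts_ge0 X.
rewrite addr_ge0 ?addr_ge0 // ?mulr_ge0 ?(ltW kap0) // sumr_ge0 // => i _; exact: sqr_ge0.
Qed.

Lemma lyap_bound V0 : 0 <= V0 -> exists2 D, 0 <= D & forall X, V X <= V0 ->
  [/\ \sum_i dot (sync_err X i) (sync_err X i) <= D, forall i, gain X i ^+ 2 <= D &
      forall i, dot (obs_err X i) (obs_err X i) <= D].
Proof.
move=> V00; have [c c0 Hc] := sync_form_coercive.
have /choice[q Hq] : forall i, exists q, 0 < q /\ forall x, q * dot x x <= Q i x x.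
  by move=> i; have [q q0 H] := Qpos i; exists q.
have D1 : 0 <= V0 / c by rewrite divr_ge0 // ltW.
have D2 : 0 <= 2 * (V0 + G ^+ 2) by rewrite mulr_ge0 // addr_ge0 // sqr_ge0.
have D3 i : 0 <= V0 / (kap * q i).
  by rewrite divr_ge0 // mulr_ge0 // ltW //; case: (Hq i).
have D4 : 0 <= \sum_i V0 / (kap * q i) by apply: sumr_ge0.
(* One summand for each kind of quantity: errors, gains, and observer errors of all agents. *)
exists (V0 / c + 2 * (V0 + G ^+ 2) + \sum_i V0 / (kap * q i)); first by lra.
move=> X VX; have [S0 Q0 VE] := lyap_parts_ge0 X.
have G0 : 0 <= \sum_i (gain X i - G) ^+ 2 by apply: sumr_ge0 => i _; exact: sqr_ge0.
have O0 : 0 <= \sum_i Q i (obs_err X i) (obs_err X i) by apply: sumr_ge0.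
have kO0 : 0 <= kap * \sum_i Q i (obs_err X i) (obs_err X i) by rewrite mulr_ge0 // ltW.
split.
- have : \sum_i dot (sync_err X i) (sync_err X i) <= V0 / c.
    by rewrite ler_pdivlMr // mulrC; apply: le_trans (Hc X) _; lra.
  lra.
- move=> i; have : (gain X i - G) ^+ 2 <= V0.
    apply: le_trans (_ : \sum_i (gain X i - G) ^+ 2 <= _); last by lra.
    by rewrite (bigD1 i) //= lerDl sumr_ge0 // => j _; exact: sqr_ge0.
  (* This square is [2 (gain - G)^2 + 2 G^2 - gain^2]. *)
  have := sqr_ge0 (gain X i - 2 * G); nra.
- move=> i; have [q0 Hqi] := Hq i.
  have : dot (obs_err X i) (obs_err X i) <= V0 / (kap * q i).
    rewrite ler_pdivlMr ?mulr_gt0 // mulrC -mulrA.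
    apply: le_trans (ler_wpM2l (ltW kap0) (Hqi _)) _.
    apply: le_trans (_ : kap * \sum_i Q i (obs_err X i) (obs_err X i) <= _); last by lra.
    by rewrite ler_pM2l // (bigD1 i) //= lerDl sumr_ge0.
  have : V0 / (kap * q i) <= \sum_i V0 / (kap * q i).
    by rewrite [leRHS](bigD1 i) //= lerDl sumr_ge0.
  lra.
Qed.

(** A sublevel set of V leaves [w] unbounded. The bound survives because the error equation sees [w]
    only inside the mismatch, which the observer error controls. *)
Lemma sync_rate_bounded V0 : 0 <= V0 -> exists2 K, 0 < K & forall X t, V X <= V0 ->
  - K <= 2 * sync_form a P (X - reference G) (F X t).
Proof.
move=> V00; have [D D0 HD] := lyap_bound V00.
have [C C0 HC] := bil_le_dot hP; have [Cl Cl0 HCl] := laplacian_dot_le a n0.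
have hS : symbilin (qform ((Smx s0)^T *m P *m Smx s0)).
  by apply: symbilin_qform; rewrite !trmx_mul trmxK P_pos.1 mulmxA.
have [Cs Cs0 HCs] := bil_le_dot hS; have [M M0 HM] := mismatch_le.
have PP x : 0 <= qform P x x.
  by have [->|/(P_pos.2)/ltW//] := eqVneq x 0; rewrite (bil0l hP).
(* Bounds the square of the total input along [d], a sum of three terms; the one with the sign
   contributes at most the squared gain. *)
pose W := 3 * (D * (C * (Cl * D) * qform P d d) + D + l ^+ 2).
have cd : 0 <= C * (Cl * D) * qform P d d by rewrite !mulr_ge0 // ltW.
have W0 : 0 <= W by rewrite /W mulr_ge0 // !addr_ge0 ?mulr_ge0 ?sqr_ge0 // ltW.
pose k i := C * (Cl * D) + 3 * (Cs * D + W * qform P d d +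
  M * D * qform P (input_row n0 ag i) (input_row n0 ag i)).
have k0 i : 0 <= k i by rewrite /k !(addr_ge0, mulr_ge0) // ltW.
exists (\sum_i k i + 1); first by rewrite ltr_wpDl // sumr_ge0.
move=> X t /HD[E1 E2 E3].
suff : - \sum_i k i <= 2 * sync_form a P (X - reference G) (F X t) by lra.
rewrite /sync_form mulr_sumr -sumrN; apply: ler_sum => i _.
rewrite sync_err_closed_loop // sync_err_reference.
set u := laplacian a (sync_err X) i; set w := gain X i * _ + _ + v t.
have uu : dot u u <= Cl * D.
  apply: le_trans (_ : \sum_i dot (laplacian a (sync_err X) i) (laplacian a (sync_err X) i) <= _).
    by rewrite (bigD1 i) //= lerDl sumr_ge0 // => j _; exact: dot_ge0.
  by apply: le_trans (HCl _) _; rewrite ler_pM2l.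
have Pu : qform P u u <= C * (Cl * D).
  by apply: le_trans (ler_norm _) _; apply: le_trans (HC u) _; rewrite ler_pM2l.
have ee : dot (sync_err X i) (sync_err X i) <= D.
  apply: le_trans E1; rewrite (bigD1 i) //= lerDl sumr_ge0 // => j _; exact: dot_ge0.
have x2 : qform P (Smx s0 *m sync_err X i) (Smx s0 *m sync_err X i) <= Cs * D.
  have -> : qform P (Smx s0 *m sync_err X i) (Smx s0 *m sync_err X i) =
      qform ((Smx s0)^T *m P *m Smx s0) (sync_err X i) (sync_err X i).
    by rewrite /qform trmx_mul !mulmxA.
  by apply: le_trans (ler_norm _) _; apply: le_trans (HCs _) _; rewrite ler_pM2l.
have ff : fb (sync_err X) i ^+ 2 <= C * (Cl * D) * qform P d d.
  rewrite /feedback -/u (bilC hP d u); apply: le_trans (bil_cauchy_schwarz hP _ _ PP) _.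
  by rewrite ler_wpM2r.
have sq3 (x y z : R) : (x + y + z) ^+ 2 <= 3 * (x ^+ 2 + y ^+ 2 + z ^+ 2).
  have := sqr_ge0 (x - y); have := sqr_ge0 (x - z); have := sqr_ge0 (y - z); nra.
have ww : w ^+ 2 <= W.
  apply: le_trans (sq3 _ _ _) _; rewrite /W ler_pM2l // !exprMn lerD // ?lerD //.
  - by apply: ler_pM; rewrite ?sqr_ge0.
  - apply: le_trans (E2 i); rewrite ler_piMr ?sqr_ge0 //.
    by rewrite -[Num.sg _ ^+ 2]real_normK ?num_real // normr_sg; case: (_ != 0); rewrite ?expr1n // expr0n.
  - by rewrite -[v t ^+ 2]real_normK ?num_real // ler_pXn2r ?nnegrE ?normr_ge0 // ltW.
have mm : mismatch X i ^+ 2 <= M * D by apply: le_trans (HM X i) _; rewrite ler_pM2l.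
set x := Smx s0 *m sync_err X i in x2 *; set y := w *: d; set b := input_row n0 ag i in k k0 *.
set z := mismatch X i *: b.
have yy : qform P y y <= W * qform P d d.
  by rewrite /y (bilZl hP) (bilZr hP) mulrA -expr2 ler_wpM2r.
have zz : qform P z z <= M * D * qform P b b.
  by rewrite /z (bilZl hP) (bilZr hP) mulrA -expr2 ler_wpM2r.
have Q3 := bil_sqr3 x y z hP PP.
have := bil_young u (x - y + z) hP PP; rewrite ler_norml => /andP[+ _].
rewrite /k -/b; lra.
Qed.

End given_lyapunov.

(** By [state_eq0] the right-hand side is a positive definite form, hence coercive; no inverse
    change of coordinates is computed. *)
Lemma state_coercive : exists2 c, 0 < c & forall X, c * dot X X <=
  dot (leader X) (leader X) + \sum_i (dot (sync_err X i) (sync_err X i) +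
   (dot (obs_err X i) (obs_err X i) + (gain X i * gain X i + dot (copy X i) (copy X i)))).
Proof.
pose B X Y := dot (leader X) (leader Y) + \sum_i (dot (sync_err X i) (sync_err Y i) +
   (dot (obs_err X i) (obs_err Y i) + (gain X i * gain Y i + dot (copy X i) (copy Y i)))).
have hB : symbilin B.
  apply: symbilin_add; first by apply: symbilin_pullback (@symbilin_dot _ _) => k x y; exact: leaderP.
  apply: symbilin_sum => i; apply: symbilin_add.
    by apply: symbilin_pullback (@symbilin_dot _ _) => k x y; exact: sync_errP.
  apply: symbilin_add.
    by apply: symbilin_pullback (@symbilin_dot _ _) => k x y; exact: obs_errP.
  apply: symbilin_add; last first.
    by apply: symbilin_pullback (@symbilin_dot _ _) => k x y; exact: copyP.
  by split=> [X Y|k X Y Z]; [rewrite mulrC|rewrite gainP; ring].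
apply: (bil_coercive hB) => X X0.
have g0 i : 0 <= gain X i * gain X i by rewrite -expr2 sqr_ge0.
have part i : 0 <= dot (sync_err X i) (sync_err X i) +
   (dot (obs_err X i) (obs_err X i) + (gain X i * gain X i + dot (copy X i) (copy X i))).
  by rewrite !addr_ge0 ?dot_ge0.
rewrite lt_neqAle addr_ge0 ?dot_ge0 ?sumr_ge0 // andbT.
apply: contra_neq X0 => /esym/eqP; rewrite paddr_eq0 ?dot_ge0 ?sumr_ge0 //.
move=> /andP[w0 /eqP S0]; have Z := psumr_eq0P (fun i _ => part i) S0.
have dot0 n (x : 'cV[R]_n) : dot x x == 0 -> x = 0.
  move=> /eqP x0; have h i : 0 <= x i 0 * x i 0 by rewrite -expr2 sqr_ge0.
  have Zx := psumr_eq0P (fun i _ => h i) x0.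
  by apply/colP => j; have /eqP := Zx j isT; rewrite mxE mulf_eq0 orbb => /eqP.
have Zi i : [/\ sync_err X i = 0, obs_err X i = 0, gain X i = 0 & copy X i = 0].
  have /eqP := Z i isT; rewrite !paddr_eq0 ?addr_ge0 ?dot_ge0 //.
  move=> /andP[h1 /andP[h2 /andP[h3 h4]]]; split; try exact: dot0.
  by move: h3; rewrite mulf_eq0 orbb => /eqP.
by apply: state_eq0 => //; [exact: dot0|..] => i; case: (Zi i).
Qed.

End lyapunov_function.

(** * Trajectories *)

Section trajectories.
Context (R : realType) (N n0 : nat) (ag : 'I_N -> agent R)
  (s0 : 'I_n0 -> R) (dn : R) (a : 'M[R]_N.+1) (P : 'M[R]_n0) (v : R -> R) (l : R).
Hypothesis n0_gt0 : (0 < n0)%N.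
Hypothesis ag_wf : forall i, agent_wf (ag i).
Hypotheses (a_weights : digraph_weights a) (a_conn : graph_connected a).
Hypothesis A2 : forall i, (xdim (ag i) <= n0)%N.
Hypothesis P_pos : posdef P.
Hypotheses (l_gt0 : 0 < l) (v_bounded : forall t, `|v t| <= l).
Local Notation T := (total_dim n0 ag (law_dim n0 ag)).
Local Notation F := (closed_loop s0 dn (K := adaptive_law ag s0 dn a P) v).
Implicit Types Y : 'cV[R]_T.

Lemma total_dim_gt0 : (0 < T)%N.
Proof. by rewrite addn_gt0 n0_gt0. Qed.

Section lyapunov_increments.
Context (Q : forall i, 'cV[R]_(zdim (ag i)) -> 'cV[R]_(zdim (ag i)) -> R) (kap G c : R).
Arguments Q : clear implicits.
Hypothesis hQ : forall i, symbilin (Q i).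
Hypothesis decay : forall Y t,
  2 * lyap a P Q kap (Y - reference n0 ag G) (F Y t) <= - c * sync_form a P Y Y.
Hypothesis c_gt0 : 0 < c.
Context (t0 t1 : R) (X : R -> 'cV[R]_T).
Hypothesis solX : filippov_solution F t0 t1 X.

Lemma lyap_increment u w r : t0 <= u -> u <= w -> w <= t1 ->
  (forall t, u <= t <= w -> r <= sync_form a P (X t) (X t)) ->
  lyap a P Q kap (X w - reference n0 ag G) (X w - reference n0 ag G) -
  lyap a P Q kap (X u - reference n0 ag G) (X u - reference n0 ag G) <= - (c * r) * (w - u).
Proof.
move=> tu uw wt Hr.
apply: (quad_increment_le total_dim_gt0 (symbilin_lyap a_conn P_pos kap hQ) _ solX) => //.
  move=> z t; have fz : id x @[x --> z] --> z by exact: cvg_id.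
  have c1 : sync_form a P (z - reference n0 ag G) (F x t) @[x --> z] -->
      sync_form a P (z - reference n0 ag G) (F z t).
    exact: (cvg_sync_form ag_wf A2 P_pos fz (sync_err_reference G z)).
  have c2 : gain_form (z - reference n0 ag G) (F x t) @[x --> z] -->
      gain_form (z - reference n0 ag G) (F z t) by exact: (cvg_gain_form P_pos fz).
  have c3 : obs_form Q (z - reference n0 ag G) (F x t) @[x --> z] -->
      obs_form Q (z - reference n0 ag G) (F z t) by apply: (cvg_obs_form fz).
  exact: cvgD (cvgD c1 c2) (cvgMl_tmp c3).
move=> t /Hr rt; apply: le_trans (decay _ _) _.
by rewrite mulNr lerN2 ler_pM2l.
Qed.

Lemma sync_increment u w K : t0 <= u -> u <= w -> w <= t1 ->
  (forall t, u <= t <= w -> - K <= 2 * sync_form a P (X t - reference n0 ag G) (F (X t) t)) ->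
  sync_form a P (X u) (X u) - sync_form a P (X w) (X w) <= K * (w - u).
Proof.
move=> tu uw wt HK.
(* [quad_increment_le] bounds growth; applied to the negated form it bounds the decrease of
   [sync_form]. *)
have hB : symbilin (fun Y Z : 'cV[R]_T => -1 * sync_form a P Y Z).
  by apply: symbilin_scale; exact: symbilin_sync_form.
have sE Y : sync_form a P (Y - reference n0 ag G) (Y - reference n0 ag G) = sync_form a P Y Y.
  by rewrite /sync_form sync_err_reference.
have := @quad_increment_le _ _ total_dim_gt0 F _ (reference n0 ag G) hB _ _ _ _ solX u w K tu uw wt.
rewrite !sE => H.
have : -1 * sync_form a P (X w) (X w) - -1 * sync_form a P (X u) (X u) <= K * (w - u).
  apply: H => [z t|t /HK]; last by lra.
  have fz : id x @[x --> z] --> z by exact: cvg_id.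
  have c1 : sync_form a P (z - reference n0 ag G) (F x t) @[x --> z] -->
      sync_form a P (z - reference n0 ag G) (F z t).
    exact: (cvg_sync_form ag_wf A2 P_pos fz (sync_err_reference G z)).
  exact: cvgMl_tmp c1.
lra.
Qed.

End lyapunov_increments.

Lemma ln_le_expR (x y : R) : 0 <= x -> ln (1 + x) <= y -> x <= expR y.
Proof.
move=> x0 xy; have : expR (ln (1 + x)) <= expR y by rewrite ler_expR.
rewrite lnK ?posrE; lra.
Qed.

Lemma leader_growth : exists2 k, 0 <= k & forall t0 t1 (X : R -> 'cV[R]_T), t0 <= t1 ->
  filippov_solution F t0 t1 X ->
  ln (1 + dot (leader (X t1)) (leader (X t1))) -
  ln (1 + dot (leader (X t0)) (leader (X t0))) <= k * (t1 - t0).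
Proof.
have hd := @symbilin_dot R n0.
have [k k0 Hk] := affine_growth (Smx s0) (mulr_ge0 (sqr_ge0 l) (dot_ge0 (dvec n0 dn))).
exists k => // t0 t1 X tt solX.
have hB : symbilin (fun Y Z : 'cV[R]_T => dot (leader Y) (leader Z)).
  by apply: symbilin_pullback hd => q x y; exact: leaderP.
have := @quad_gronwall _ _ total_dim_gt0 F _ 0 hB _ _ _ _ solX t0 t1 k (lexx _) tt (lexx _).
rewrite !subr0; apply=> [z t|x|t _]; first 2 last.
- rewrite subr0 leader_closed_loop; apply: Hk.
  rewrite (bilZl hd) (bilZr hd) mulrA -expr2 ler_wpM2r ?dot_ge0 //.
  by rewrite -[v t ^+ 2]real_normK ?num_real // ler_pXn2r ?nnegrE ?normr_ge0 // ltW.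
- have fz : id x @[x --> z] --> z by exact: cvg_id.
  exact: (cvg_leader_form fz).
- exact: dot_ge0.
Qed.

Lemma copy_growth i H : 0 <= H -> exists2 k, 0 <= k &
  forall t0 t1 (X : R -> 'cV[R]_T), t0 <= t1 -> filippov_solution F t0 t1 X ->
  (forall t, t0 <= t <= t1 ->
     dot (agent_f (plant (X t) i)) (agent_f (plant (X t) i)) <= H) ->
  ln (1 + dot (copy (X t1) i) (copy (X t1) i)) -
  ln (1 + dot (copy (X t0) i) (copy (X t0) i)) <= k * (t1 - t0).
Proof.
move=> H0; have hd := @symbilin_dot R (zdim (ag i)).
have [k k0 Hk] := affine_growth (agent_A (ag i)) H0.
exists k => // t0 t1 X tt solX HX.
have hB : symbilin (fun Y Z : 'cV[R]_T => dot (copy Y i) (copy Z i)).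
  by apply: symbilin_pullback hd => q x y; exact: copyP.
have := @quad_gronwall _ _ total_dim_gt0 F _ 0 hB _ _ _ _ solX t0 t1 k (lexx _) tt (lexx _).
rewrite !subr0; apply=> [z t|x|t /HX fH]; first 2 last.
- by rewrite subr0 copy_closed_loop; exact: Hk.
- have fz : id x @[x --> z] --> z by exact: cvg_id.
  exact: (cvg_copy_form ag_wf fz).
- exact: dot_ge0.
Qed.

(** The order of the bounds is forced: the leader evolves alone, [xhat = e + w] then bounds the
    plant states, these bound the drive [agent_f] of [xi], and only then is the whole state
    bounded. *)
Lemma no_finite_escape (t0 t1 D : R) (X : R -> 'cV[R]_T) : t0 < t1 ->
  (forall t, t0 < t < t1 -> filippov_solution F t0 t X) ->
  (forall t, t0 <= t < t1 ->
    [/\ \sum_i dot (sync_err (X t) i) (sync_err (X t) i) <= D,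
        forall i, gain (X t) i ^+ 2 <= D &
        forall i, dot (obs_err (X t) i) (obs_err (X t) i) <= D]) ->
  exists C : R, forall t, t0 <= t < t1 -> enorm (X t) <= C.
Proof.
move=> tt solX HD.
(* Solutions are supplied only on intervals of positive length, so [t = t0] is apart. *)
have solE t : t0 <= t < t1 -> t = t0 \/ filippov_solution F t0 t X.
  move=> /andP[]; rewrite le_eqVlt => /orP[/eqP->|lt tt1]; [by left|right].
  by apply: solX; rewrite lt tt1.
have [k k0 Hk] := leader_growth.
pose Lw := expR (ln (1 + dot (leader (X t0)) (leader (X t0))) + k * (t1 - t0)).
have HL t : t0 <= t < t1 -> dot (leader (X t)) (leader (X t)) <= Lw.
  move=> tin; apply: ln_le_expR; first exact: dot_ge0.
  have kt : k * (t - t0) <= k * (t1 - t0) by rewrite ler_wpM2l //; lra.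
  have k1 : 0 <= k * (t1 - t0) by rewrite mulr_ge0 //; lra.
  case: (solE t tin) => [->|sol]; first by lra.
  by have := Hk t0 t X ltac:(lra) sol; lra.
have hd := @symbilin_dot R n0.
have Hx t i : t0 <= t < t1 ->
    dot (xhat (unpack (X t)) i) (xhat (unpack (X t)) i) <= 2 * (D + Lw).
  move=> tin; rewrite xhatE; apply: le_trans (bil_sqr2 _ _ hd (@dot_ge0 _ _)) _.
  have := HL t tin; have [E1 _ _] := HD t tin.
  have : dot (sync_err (X t) i) (sync_err (X t) i) <= D.
    by apply: le_trans E1; rewrite (bigD1 i) //= lerDl sumr_ge0 // => j _; exact: dot_ge0.
  lra.
have /choice[Cc HCc] : forall i, exists C, forall t, t0 <= t < t1 ->
    dot (copy (X t) i) (copy (X t) i) <= C.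
  move=> i; have [_ _ /(_ 0%N) /= cf _] := ag_wf i.
  have [H H0 Hf] := continuous_bounded_on_ball ((xdim (ag i))%:R * (2 * (D + Lw))) cf.
  have [k' k'0 Hk'] := copy_growth i H0.
  exists (expR (ln (1 + dot (copy (X t0) i) (copy (X t0) i)) + k' * (t1 - t0))).
  move=> t tin; apply: ln_le_expR; first exact: dot_ge0.
  have kt : k' * (t - t0) <= k' * (t1 - t0) by rewrite ler_wpM2l //; lra.
  have k1 : 0 <= k' * (t1 - t0) by rewrite mulr_ge0 //; lra.
  case: (solE t tin) => [->|sol]; first by lra.
  have := Hk' t0 t X ltac:(lra) sol; rewrite lerBlDr => /(_ _)/le_trans; apply; last by lra.
  move=> s sin; apply: Hf.
  rewrite mulr_natl -[X in _ *+ X]card_ord -sumr_const; apply: ler_sum => j _.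
  rewrite (plant_xhat _ _ (A2 i)) -expr2.
  apply: le_trans (Hx s i ltac:(lra)).
  rewrite [leRHS](bigD1 (widen_ord (A2 i) j)) //= -expr2 lerDl.
  by apply: sumr_ge0 => q _; rewrite -expr2 sqr_ge0.
have [c c0 Hc] := state_coercive A2.
(* The final 1 converts a bound on the squared norm into one on the norm. *)
exists (c^-1 * (Lw + \sum_i (D + (D + (D + Cc i)))) + 1).
move=> t tin; have [E1 E2 E3] := HD t tin.
have : dot (X t) (X t) <= c^-1 * (Lw + \sum_i (D + (D + (D + Cc i)))).
  rewrite ler_pdivlMl //; apply: le_trans (Hc _) _; apply: lerD; first exact: HL.
  apply: ler_sum => i _; rewrite !lerD ?HCc //; last by rewrite -expr2.
  by apply: le_trans E1; rewrite (bigD1 i) //= lerDl sumr_ge0 // => j _; exact: dot_ge0.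
rewrite -enorm_sqr; have := enorm_ge0 (X t); have := sqr_ge0 (enorm (X t) - 1); nra.
Qed.

End trajectories.

Unset Implicit Arguments.

Theorem theorem3 (R : realType) (N n0 : nat) (ag : 'I_N -> agent R)
    (s0 : 'I_n0 -> R) (dn : R) (a : 'M[R]_N.+1) (P : 'M[R]_n0)
    (n0_gt0 : (0 < n0)%N)
    (ag_wf : forall i, agent_wf (ag i))
    (dn_neq0 : dn != 0)
    (a_weights : digraph_weights a)
    (A1 : graph_connected a)
    (A2 : forall i, (xdim (ag i) <= n0)%N)
    (A3 : forall i, exists2 M : R, 0 < M &
      forall (z Delta : 'cV[R]_(zdim (ag i))) (x : 'cV[R]_(xdim (ag i))),
        `|agent_g (z + Delta) x - agent_g z x| <= M * enorm Delta)
    (P_posdef : posdef P)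
    (P_lmi : posdef (2%:R *: (P *m dvec n0 dn *m (dvec n0 dn)^T *m P)
                     - ((Smx s0)^T *m P + P *m Smx s0))) :
  solves_coordination s0 dn (adaptive_law ag s0 dn a P).
Proof.
move=> v cv [l l0 vl] t0 X0 X _.
have [Q [kap [G [c [hQ Qpos kap0 c0 decay]]]]] :=
  lyapunov_exists ag_wf a_weights A1 A2 A3 P_posdef P_lmi l0 vl.
pose V t := lyap a P Q kap (X t - reference n0 ag G) (X t - reference n0 ag G).
pose W t := sync_form a P (X t) (X t).
have V0 t : 0 <= V t by exact: lyap_ge0.
have W0 t : 0 <= W t.
  by have [] := lyap_parts_ge0 a_weights A1 P_posdef kap G Qpos (X t).
have Vdecr u w t1 r : t0 <= u -> u <= w -> w <= t1 ->
    filippov_solution (closed_loop s0 dn (K := adaptive_law ag s0 dn a P) v) t0 t1 X ->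
    (forall t, u <= t <= w -> r <= W t) -> V w - V u <= - (c * r) * (w - u).
  by move=> tu uw wt sol; exact: (lyap_increment n0_gt0 ag_wf A1 A2 P_posdef hQ decay c0 sol).
have Vle t : t0 <= t -> (t0 < t ->
    filippov_solution (closed_loop s0 dn (K := adaptive_law ag s0 dn a P) v) t0 t X) ->
    V t <= V t0.
  move=> tt sol; have [->//|tt0] := eqVneq t t0.
  have {}sol := sol ltac:(by rewrite lt_neqAle eq_sym tt0).
  have := Vdecr t0 t t 0 (lexx _) tt (lexx _) sol (fun s _ => W0 s).
  by rewrite mulr0 oppr0 mul0r subr_le0.
split=> [t1 tt1 sol|sol i].
  have [D D0 HD] := lyap_bound a_weights A1 P_posdef G Qpos kap0 (V0 t0).
  apply: (no_finite_escape n0_gt0 ag_wf A2 l0 vl tt1 sol) => t /andP[tt tt'].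
  by apply: HD; apply: Vle => // lt; apply: sol; rewrite lt tt'.
have [K K0 HK] := sync_rate_bounded s0 dn a_weights A1 A2 A3 P_posdef l0 vl G Qpos kap0 (V0 t0).
have VV t : t0 <= t -> V t <= V t0 by move=> tt; apply: Vle => // lt; exact: sol.
have Wto0 : W t @[t --> +oo] --> 0.
  apply: (@decay_to_zero _ t0 c K V W) => // [u w tu uw|u w r tu uw].
    (* The horizon [w + 1] is strictly beyond [t0] even when [w = t0]. *)
    apply: (sync_increment n0_gt0 ag_wf A1 A2 P_posdef (sol (w + 1) _)) => //; [lra|lra|].
    by move=> t utw; apply: HK; apply: VV; lra.
  by apply: (Vdecr u w (w + 1)) => //; [lra|apply: sol; lra].
have [q q0 Hq] := sync_form_coercive ag a_weights A1 P_posdef.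
apply/cvgrPdist_le => /= e e0.
(* By coercivity, [W <= q * e ^+ 2] forces each entry of the synchronization errors to be at most
   [e] in absolute value. *)
have qe : 0 < q * e ^+ 2 by rewrite mulr_gt0 // exprn_gt0.
move/cvgrPdist_le : Wto0 => /(_ _ qe) /=; apply: filterS => t.
rewrite !sub0r !normrN (ger0_norm (W0 t)) => Wt.
have ag_pos j : (1 <= xdim (ag j))%N by case: (ag_wf j).
rewrite (tracking_errorE ag_pos A2).
set o := Ordinal _.
have h1 : sync_err (X t) i o 0 ^+ 2 <= e ^+ 2.
  rewrite -(ler_pM2l q0); apply: le_trans Wt; apply: le_trans (Hq (X t)).
  rewrite ler_pM2l // (bigD1 i) //= {1}/dot (bigD1 o) //= -expr2 -addrA lerDl.
  rewrite addr_ge0 ?sumr_ge0 // => j _; last exact: dot_ge0.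
  by rewrite -expr2 sqr_ge0.
by rewrite -(ler_pXn2r (ltn0Sn 1)) ?nnegrE ?(ltW e0) // real_normK ?num_real.
Qed.
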